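(* The derivability problems for each of the multiplicative fragments $\mathcal{F}^{\mathrm{mult}}_{2015}$, $\mathcal{F}^{\mathrm{mult}}_{2018}$ and $\mathcal{F}^{-,\mathrm{mult}}_{2018}$ of the stoup-free calculi defined below are algorithmically undecidable.
   Context: Formulae are built from a countable set of variables and the constant $\mathbf{1}$ by the binary connectives $\backslash$, $/$, $\cdot$, $\wedge$, $\vee$ and the unary connectives $\langle\rangle$, $[]^{-1}$ (bracket modalities) and $!$. A tree term is a formula or an expression $[\Xi]$ with $\Xi$ a meta-formula; a meta-formula is a finite linearly ordered sequence of tree terms (the empty sequence is $\Lambda$). A sequent is $\Xi\to C$, $\Xi$ a meta-formula, $C$ a formula. $\Xi(\Theta)$ denotes a meta-formula with a designated occurrence of a meta-formula $\Theta$ that is either $\Xi$ itself or the full content of some bracket $[\Theta]$ at any depth in $\Xi$; $\Xi(\Theta')$ is the result of replacing it. Common axioms and rules ($A,B,C,D,A_i$ formulae, $\Gamma,\Delta,\Delta_i,\Gamma_i,\Phi,\Pi$ sequences of tree terms): axioms $A\to A$, $\Lambda\to\mathbf1$; ($/L$) from $\Gamma\to B$ and $\Xi(\Delta_1,C,\Delta_2)\to D$ infer $\Xi(\Delta_1,C/B,\Gamma,\Delta_2)\to D$; ($/R$) from $\Gamma,B\to C$ infer $\Gamma\to C/B$; ($\backslash L$) from $\Gamma\to A$ and $\Xi(\Delta_1,C,\Delta_2)\to D$ infer $\Xi(\Delta_1,\Gamma,A\backslash C,\Delta_2)\to D$; ($\backslash R$) from $A,\Gamma\to C$ infer $\Gamma\to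 A\backslash C$; ($\cdot L$) from $\Xi(\Delta_1,A,B,\Delta_2)\to D$ infer $\Xi(\Delta_1,A\cdot B,\Delta_2)\to D$; ($\cdot R$) from $\Delta\to A$ and $\Gamma\to B$ infer $\Delta,\Gamma\to A\cdot B$; ($\mathbf1L$) from $\Xi(\Delta_1,\Delta_2)\to A$ infer $\Xi(\Delta_1,\mathbf1,\Delta_2)\to A$; ($\vee L$) from $\Xi(\Delta_1,A_1,\Delta_2)\to C$ and $\Xi(\Delta_1,A_2,\Delta_2)\to C$ infer $\Xi(\Delta_1,A_1\vee A_2,\Delta_2)\to C$; ($\vee R_i$) from $\Xi\to A_i$ infer $\Xi\to A_1\vee A_2$; ($\wedge L_i$) from $\Xi(\Delta_1,A_i,\Delta_2)\to C$ infer $\Xi(\Delta_1,A_1\wedge A_2,\Delta_2)\to C$; ($\wedge R$) from $\Xi\to A_1$ and $\Xi\to A_2$ infer $\Xi\to A_1\wedge A_2$; ($[]^{-1}L$) from $\Xi(\Delta_1,A,\Delta_2)\to B$ infer $\Xi(\Delta_1,[[]^{-1}A],\Delta_2)\to B$; ($[]^{-1}R$) from $[\Xi]\to A$ infer $\Xi\to[]^{-1}A$; ($\langle\rangle L$) from $\Xi(\Delta_1,[A],\Delta_2)\to B$ infer $\Xi(\Delta_1,\langle\rangle A,\Delta_2)\to B$; ($\langle\rangle R$) from $\Xi\to A$ infer $[\Xi]\to\langle\rangle A$; ($!L$) from $\Xi(\Delta_1,A,\Delta_2)\to C$ infer $\Xi(\Delta_1,!A,\Delta_2)\to C$; ($!P_1$)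 from $\Xi(\Delta_1,!A,\Phi,\Delta_2)\to C$ infer $\Xi(\Delta_1,\Phi,!A,\Delta_2)\to C$; ($!P_2$) from $\Xi(\Delta_1,\Phi,!A,\Delta_2)\to C$ infer $\Xi(\Delta_1,!A,\Phi,\Delta_2)\to C$; (cut) from $\Pi\to A$ and $\Xi(\Gamma_1,A,\Gamma_2)\to C$ infer $\Xi(\Gamma_1,\Pi,\Gamma_2)\to C$. $\mathcal{F}_{2015}$: common rules plus ($!R$) from $!A_1,\dots,!A_n\to B$ infer $!A_1,\dots,!A_n\to !B$ ($n\ge1$) and ($!C$) from $\Xi(!A_1,\dots,!A_n,\Gamma_1,[!A_1,\dots,!A_n,\Gamma_2],\Gamma_3)\to C$ infer $\Xi(!A_1,\dots,!A_n,\Gamma_1,\Gamma_2,\Gamma_3)\to C$ ($n\ge1$). $\mathcal{F}_{2018}$: common rules plus ($!R$) from $!A\to B$ infer $!A\to!B$ and ($!C$) from $\Xi(!A,\Gamma_1,[!A,\Gamma_2],\Gamma_3)\to C$ infer $\Xi(!A,\Gamma_1,[[\Gamma_2]],\Gamma_3)\to C$. $\mathcal{F}^{-}_{2018}$ (Lambek's restriction): $\mathcal{F}_{2018}$ restricted to formulae without $\mathbf1$, without the axiom $\Lambda\to\mathbf1$ and rule $\mathbf1L$, with $\backslash R$ and $/R$ allowed only if $\Gamma\ne\Lambda$ and $!C$ allowed only if $\Gamma_2\neq\Lambda$. The multiplicative fragment (superscript $\mathrm{mult}$) of a calculus uses only formulae without $\wedge,\vee$ and omits the rules for $\wedge,\vee$.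 The derivability problem asks, given a sequent, whether it is derivable. *)

(* Defs.v *)
From Stdlib Require Import List Arith.
Import ListNotations.

Inductive formula : Type :=
| Var   : nat -> formula
| One   : formula
| Under : formula -> formula -> formula  (* Under A C  =  A \ C *)
| Over  : formula -> formula -> formula  (* Over C B   =  C / B *)
| Prod  : formula -> formula -> formula
| And   : formula -> formula -> formula
| Or    : formula -> formula -> formula
| Diam  : formula -> formula
| Box   : formula -> formula
| Bang  : formula -> formula.

Inductive tterm : Type :=
| TF : formula -> tterm
| TB : list tterm -> tterm.        (* a bracketed meta-formula [Xi] *)

Definition meta := list tterm.

(* Contexts Xi( . ) : the designated occurrence is either the whole
   meta-formula or the full content of some bracket at any depth. *)
Inductive ctx : Type :=
| Hole : ctx
| InBr : meta -> ctx -> meta -> ctx.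

Fixpoint plug (X : ctx) (T : meta) : meta :=
  match X with
  | Hole => T
  | InBr l Y r => l ++ TB (plug Y T) :: r
  end.

Inductive calc : Type := F2015 | F2018 | F2018minus.

Fixpoint mult_free (A : formula) : bool :=
  match A with
  | Var _ | One => true
  | Under A B | Over A B | Prod A B => mult_free A && mult_free B
  | And _ _ | Or _ _ => false
  | Diam A | Box A | Bang A => mult_free A
  end.

Fixpoint one_free (A : formula) : bool :=
  match A with
  | Var _ => true
  | One => false
  | Under A B | Over A B | Prod A B | And A B | Or A B => one_free A && one_free B
  | Diam A | Box A | Bang A => one_free A
  end.

Definition frag_formula (c : calc) (A : formula) : Prop :=
  mult_free A = true /\ (c = F2018minus -> one_free A = true).

Fixpoint tterm_in_frag (c : calc) (t : tterm) : Prop :=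
  match t with
  | TF A => frag_formula c A
  | TB l => (fix go (l : list tterm) : Prop :=
               match l with
               | [] => True
               | x :: r => tterm_in_frag c x /\ go r
               end) l
  end.

Definition frag_sequent (c : calc) (Xi : meta) (C : formula) : Prop :=
  Forall (tterm_in_frag c) Xi /\ frag_formula c C.

Definition bangs (As : list formula) : meta := map (fun A => TF (Bang A)) As.

(* deriv c Xi C : the sequent Xi -> C is derivable in the multiplicative
   fragment of calculus c (no rules for /\, \/; cut formulae and axiom
   formulae range over formulae of the fragment). *)
Inductive deriv (c : calc) : meta -> formula -> Prop :=
| d_ax : forall A, frag_formula c A -> deriv c [TF A] A
| d_ax1 : c <> F2018minus -> deriv c [] One
| d_overL : forall X D1 D2 G B C D,
    deriv c G B -> deriv c (plug X (D1 ++ TF C :: D2)) D ->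
    deriv c (plug X (D1 ++ TF (Over C B) :: G ++ D2)) D
| d_overR : forall G B C,
    (c = F2018minus -> G <> []) ->
    deriv c (G ++ [TF B]) C -> deriv c G (Over C B)
| d_underL : forall X D1 D2 G A C D,
    deriv c G A -> deriv c (plug X (D1 ++ TF C :: D2)) D ->
    deriv c (plug X (D1 ++ G ++ TF (Under A C) :: D2)) D
| d_underR : forall G A C,
    (c = F2018minus -> G <> []) ->
    deriv c (TF A :: G) C -> deriv c G (Under A C)
| d_prodL : forall X D1 D2 A B D,
    deriv c (plug X (D1 ++ TF A :: TF B :: D2)) D ->
    deriv c (plug X (D1 ++ TF (Prod A B) :: D2)) D
| d_prodR : forall D G A B,
    deriv c D A -> deriv c G B -> deriv c (D ++ G) (Prod A B)
| d_oneL : forall X D1 D2 A,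
    c <> F2018minus ->
    deriv c (plug X (D1 ++ D2)) A -> deriv c (plug X (D1 ++ TF One :: D2)) A
| d_boxL : forall X D1 D2 A B,
    deriv c (plug X (D1 ++ TF A :: D2)) B ->
    deriv c (plug X (D1 ++ TB [TF (Box A)] :: D2)) B
| d_boxR : forall Xi A, deriv c [TB Xi] A -> deriv c Xi (Box A)
| d_diamL : forall X D1 D2 A B,
    deriv c (plug X (D1 ++ TB [TF A] :: D2)) B ->
    deriv c (plug X (D1 ++ TF (Diam A) :: D2)) B
| d_diamR : forall Xi A, deriv c Xi A -> deriv c [TB Xi] (Diam A)
| d_bangL : forall X D1 D2 A C,
    deriv c (plug X (D1 ++ TF A :: D2)) C ->
    deriv c (plug X (D1 ++ TF (Bang A) :: D2)) C
| d_bangP1 : forall X D1 D2 A Phi C,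
    deriv c (plug X (D1 ++ TF (Bang A) :: Phi ++ D2)) C ->
    deriv c (plug X (D1 ++ Phi ++ TF (Bang A) :: D2)) C
| d_bangP2 : forall X D1 D2 A Phi C,
    deriv c (plug X (D1 ++ Phi ++ TF (Bang A) :: D2)) C ->
    deriv c (plug X (D1 ++ TF (Bang A) :: Phi ++ D2)) C
| d_cut : forall Pi A X G1 G2 C,
    frag_formula c A ->
    deriv c Pi A -> deriv c (plug X (G1 ++ TF A :: G2)) C ->
    deriv c (plug X (G1 ++ Pi ++ G2)) C
| d_bangR15 : forall As B,
    c = F2015 -> As <> [] ->
    deriv c (bangs As) B -> deriv c (bangs As) (Bang B)
| d_bangC15 : forall X As G1 G2 G3 C,
    c = F2015 -> As <> [] ->
    deriv c (plug X (bangs As ++ G1 ++ TB (bangs As ++ G2) :: G3)) C ->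
    deriv c (plug X (bangs As ++ G1 ++ G2 ++ G3)) C
| d_bangR18 : forall A B,
    c <> F2015 ->
    deriv c [TF (Bang A)] B -> deriv c [TF (Bang A)] (Bang B)
| d_bangC18 : forall X A G1 G2 G3 C,
    c <> F2015 -> (c = F2018minus -> G2 <> []) ->
    deriv c (plug X (TF (Bang A) :: G1 ++ TB (TF (Bang A) :: G2) :: G3)) C ->
    deriv c (plug X (TF (Bang A) :: G1 ++ TB [TB G2] :: G3)) C.

Definition cpair (x y : nat) : nat := (x + y) * (x + y + 1) / 2 + y.

Fixpoint code_f (A : formula) : nat :=
  match A with
  | Var n => cpair 0 n
  | One => cpair 1 0
  | Under A B => cpair 2 (cpair (code_f A) (code_f B))
  | Over A B => cpair 3 (cpair (code_f A) (code_f B))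
  | Prod A B => cpair 4 (cpair (code_f A) (code_f B))
  | And A B => cpair 5 (cpair (code_f A) (code_f B))
  | Or A B => cpair 6 (cpair (code_f A) (code_f B))
  | Diam A => cpair 7 (code_f A)
  | Box A => cpair 8 (code_f A)
  | Bang A => cpair 9 (code_f A)
  end.

Fixpoint code_t (t : tterm) : nat :=
  match t with
  | TF A => cpair 0 (code_f A)
  | TB l => cpair 1 ((fix go (l : list tterm) : nat :=
                        match l with
                        | [] => 0
                        | x :: r => S (cpair (code_t x) (go r))
                        end) l)
  end.

Fixpoint code_m (l : meta) : nat :=
  match l with
  | [] => 0
  | x :: r => S (cpair (code_t x) (code_m r))
  end.

Definition code_seq (Xi : meta) (C : formula) : nat := cpair (code_m Xi) (code_f C).

Inductive recf : Type :=
| RZero : recf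
| RSucc : recf
| RProj : nat -> recf
| RComp : recf -> list recf -> recf
| RPrim : recf -> recf -> recf
| RMu   : recf -> recf.

Inductive eval : recf -> list nat -> nat -> Prop :=
| e_zero : forall v, eval RZero v 0
| e_succ : forall v, eval RSucc v (S (hd 0 v))
| e_proj : forall i v, eval (RProj i) v (nth i v 0)
| e_comp : forall f gs v ys y,
    evalL gs v ys -> eval f ys y -> eval (RComp f gs) v y
| e_prim0 : forall f g v y, eval f v y -> eval (RPrim f g) (0 :: v) y
| e_primS : forall f g n v r y,
    eval (RPrim f g) (n :: v) r -> eval g (n :: r :: v) y ->
    eval (RPrim f g) (S n :: v) y
| e_mu : forall f v n,
    eval f (n :: v) 0 ->
    (forall m, m < n -> exists k, eval f (m :: v) (S k)) ->
    eval (RMu f) v n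
with evalL : list recf -> list nat -> list nat -> Prop :=
| eL_nil : forall v, evalL [] v []
| eL_cons : forall g gs v y ys,
    eval g v y -> evalL gs v ys -> evalL (g :: gs) v (y :: ys).

Definition derivability_decidable (c : calc) : Prop :=
  exists f : recf,
    forall (Xi : meta) (C : formula), frag_sequent c Xi C ->
      (deriv c Xi C -> eval f [code_seq Xi C] 1) /\
      (~ deriv c Xi C -> eval f [code_seq Xi C] 0).

(* Main.v *)
From Stdlib Require Import List Arith Lia FunctionalExtensionality.
Require Import Defs.
Import ListNotations.

(** Counter programs are encoded as follows. A configuration is a word with a
    head marking the current program point, and a program is a set of local
    rewriting rules [u q v => u' q' v']. A rule becomes the formula
    [!(([]^{-1} (u\(u' q' v')/v)) / q)]: contraction shuts [q] in a bracket
    together with a copy of the formula, which consumes [q] and dissolves the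
    bracket, so that termination of the program gives a derivation. There is no
    weakening, so the rules are repeated in the succedent. Conversely, all rules,
    cut included, are sound in a model in sets of words that forgets the
    brackets and is closed under reverse rewriting, so that a derivation gives
    termination. A recursive decision procedure for derivability could then be
    turned into a program that halts on its own code exactly when the sequent
    saying so is not derivable. *)

(** * A model in sets of words *)

(** Cut is a primitive rule, so a derivation need not consist of subformulae of its end sequent and
    cannot simply be read back as a run; this is why the passage from derivations to runs is
    semantic. With brackets erased, the contraction rules of 2015 and 2018 become the same
    contraction of [!], so that one model serves all three calculi. In the other direction the
    derivations have to respect Lambek's restriction: they use no right rule for the two slashes,
    contraction always encloses the nonempty [q], and the formulae avoid the unit. Programs are
    structured and run on a stack of commands. Only finitely many stacks can occur; they are the
    states of the head, which keeps the alphabet finite. Registers are stored in unary as letters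
    among which the head moves freely, and the only test, emptiness of a register, is a scan from
    one end marker to the other. *)

Section Model.

Context {T : Type} (P : list T -> Prop) (val : nat -> list T).

(** The contextual preorder of the language [P], as for syntactic monoids. Formulae denote down-sets
    of it. If [P] is closed under reverse rewriting, the left side of a rule lies below its right
    side. *)
Definition below (u v : list T) : Prop :=
  forall l r, P (l ++ v ++ r) -> P (l ++ u ++ r).

Lemma below_refl u : below u u.
Proof. now intros l r. Qed.

Lemma below_trans u v w : below u v -> below v w -> below u w.
Proof. intros H1 H2 l r H. now apply H1, H2. Qed.

Lemma below_app u u' v v' : below u u' -> below v v' -> below (u ++ v) (u' ++ v').
Proof.
  intros H1 H2 l r H.
  specialize (H1 l (v ++ r)). specialize (H2 (l ++ u') r).
  rewrite <- !app_assoc in *. auto.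
Qed.

(* Brackets are invisible in the model, and [!A] holds only of words below
   the empty one, which makes permutation and contraction trivially sound. *)
Fixpoint fsem (A : formula) (w : list T) : Prop :=
  match A with
  | Var n => below w (val n)
  | One => below w []
  | Under A B => forall a, fsem A a -> fsem B (a ++ w)
  | Over C B => forall b, fsem B b -> fsem C (w ++ b)
  | Prod A B => exists a b, fsem A a /\ fsem B b /\ below w (a ++ b)
  | And A B => fsem A w /\ fsem B w
  | Or A B => fsem A w \/ fsem B w
  | Diam A | Box A => fsem A w
  | Bang A => below w [] /\ fsem A []
  end.

Fixpoint tsem (t : tterm) (w : list T) : Prop :=
  match t with
  | TF A => fsem A w
  | TB l => (fix go (l : list tterm) (w : list T) : Prop :=
               match l with
               | [] => w = []
               | x :: r => exists a b, w = a ++ b /\ tsem x a /\ go r b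
               end) l w
  end.

Definition msem (l : meta) (w : list T) : Prop := tsem (TB l) w.

Lemma msem_cons t l w :
  msem (t :: l) w <-> exists a b, w = a ++ b /\ tsem t a /\ msem l b.
Proof. reflexivity. Qed.

Lemma msem_1E t w : msem [t] w -> tsem t w.
Proof.
  intros (a & b & -> & H & Hb). simpl in Hb. subst b. now rewrite app_nil_r.
Qed.

Lemma msem_1I t w : tsem t w -> msem [t] w.
Proof. intros H. exists w, []. rewrite app_nil_r. now repeat split. Qed.

Lemma msem_app l r w :
  msem (l ++ r) w <-> exists a b, w = a ++ b /\ msem l a /\ msem r b.
Proof.
  revert w; induction l as [|t l IH]; intros w; simpl app.
  - split.
    + intros H. exists [], w. now repeat split.
    + intros (a & b & -> & Ha & Hb). red in Ha. simpl in Ha. now subst a.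
  - rewrite msem_cons. split.
    + intros (a & b & -> & Ha & Hb). apply IH in Hb as (b1 & b2 & -> & H1 & H2).
      exists (a ++ b1), b2. rewrite app_assoc. repeat split; auto.
      apply msem_cons. eauto.
    + intros (a & b & -> & Ha & Hb). apply msem_cons in Ha as (a1 & a2 & -> & H1 & H2).
      exists a1, (a2 ++ b). rewrite app_assoc. repeat split; auto.
      apply IH. eauto.
Qed.

Lemma fsem_below A u v : below u v -> fsem A v -> fsem A u.
Proof.
  revert u v; induction A; simpl; intros u v Huv; eauto using below_trans.
  - intros H a Ha. eauto using below_app, below_refl.
  - intros H a Ha. eauto using below_app, below_refl.
  - intros (a & b & Ha & Hb & H). exists a, b. eauto using below_trans.
  - intros [H1 H2]. eauto.
  - intros [H|H]; eauto.
  - intros [H1 H2]. eauto using below_trans.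
Qed.

(** Inclusion up to [below]: the left rules for product, unit and [!] only yield a word above the
    given one, not that word itself. The relation is stable under every context. *)
Definition refines (S S' : meta) : Prop :=
  forall w, msem S w -> exists w', msem S' w' /\ below w w'.

Lemma refines_refl S : refines S S.
Proof. intros w Hw. exists w. eauto using below_refl. Qed.

Lemma refines_app S S' U U' :
  refines S S' -> refines U U' -> refines (S ++ U) (S' ++ U').
Proof.
  intros H1 H2 w Hw. apply msem_app in Hw as (a & b & -> & Ha & Hb).
  apply H1 in Ha as (a' & Ha & La). apply H2 in Hb as (b' & Hb & Lb).
  exists (a' ++ b'). split; [apply msem_app; eauto | now apply below_app].
Qed.

Lemma refines_TB S S' : refines S S' -> refines [TB S] [TB S'].
Proof.
  intros H w Hw. apply msem_1E, H in Hw as (w' & Hw & L).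
  exists w'. split; auto. now apply msem_1I.
Qed.

Lemma refines_plug X S S' : refines S S' -> refines (plug X S) (plug X S').
Proof.
  intros H; induction X as [|l X IH r]; simpl; auto.
  apply refines_app; [apply refines_refl|].
  apply (refines_app [_] [_]); [now apply refines_TB | apply refines_refl].
Qed.

Lemma refines_at X D1 D2 S S' :
  refines S S' -> refines (plug X (D1 ++ S ++ D2)) (plug X (D1 ++ S' ++ D2)).
Proof. intros H. eauto using refines_plug, refines_app, refines_refl. Qed.

Definition valid (S : meta) (C : formula) : Prop :=
  forall w, msem S w -> fsem C w.

Lemma valid_refines S S' C : refines S S' -> valid S' C -> valid S C.
Proof. intros H V w Hw. apply H in Hw as (w' & Hw & L). eauto using fsem_below. Qed.

Lemma valid_at X D1 D2 S S' C :
  refines S S' -> valid (plug X (D1 ++ S' ++ D2)) C ->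
  valid (plug X (D1 ++ S ++ D2)) C.
Proof. intros H. now apply valid_refines, refines_at. Qed.

Lemma refines_formulas A B :
  (forall w, fsem A w -> exists w', fsem B w' /\ below w w') ->
  refines [TF A] [TF B].
Proof.
  intros H w Hw. apply msem_1E in Hw. apply H in Hw as (w' & Hw & L).
  exists w'. split; auto. now apply msem_1I.
Qed.

(** The word of [!A] is below the empty word, and [!A] also holds of the empty word, so the formula
    can reappear at the other end with empty content. *)
Lemma refines_bang A Phi : refines (TF (Bang A) :: Phi) (Phi ++ [TF (Bang A)]).
Proof.
  intros w Hw. apply msem_cons in Hw as (a & b & -> & Ha & Hb).
  exists (b ++ []). split.
  - apply msem_app. exists b, []. repeat split; auto.
    apply msem_1I. split; [apply below_refl | apply Ha].
  - rewrite app_nil_r. apply (below_app a [] b b); [apply Ha | apply below_refl].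
Qed.

Lemma refines_bang_r A Phi : refines (Phi ++ [TF (Bang A)]) (TF (Bang A) :: Phi).
Proof.
  intros w Hw. apply msem_app in Hw as (b & a & -> & Hb & Ha).
  apply msem_1E in Ha.
  exists b. split.
  - apply msem_cons. exists [], b. repeat split; auto; [apply below_refl | apply Ha].
  - rewrite <- (app_nil_r b) at 2. apply below_app; [apply below_refl | apply Ha].
Qed.

Lemma msem_bangs As w : msem (bangs As) w -> below w [] /\ msem (bangs As) [].
Proof.
  revert w; induction As as [|A As IH]; intros w Hw.
  - red in Hw. simpl in Hw. subst w. split; [apply below_refl | reflexivity].
  - apply msem_cons in Hw as (a & b & -> & Ha & Hb). apply IH in Hb as [L Hb].
    split; [apply (below_app a [] b []); [apply Ha | exact L]|].
    apply msem_cons. exists [], []. repeat split; auto; [apply below_refl | apply Ha].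
Qed.

(** Right rules unfold the semantics. A left rule, and likewise cut, permutation and contraction,
    replaces a block of the antecedent by one that refines it. *)
Lemma soundness c Xi C : deriv c Xi C -> valid Xi C.
Proof.
  induction 1 as
    [A _ | _ | X D1 D2 G B C D _ IH1 _ IH2 | G B C _ _ IH
    | X D1 D2 G A C D _ IH1 _ IH2 | G A C _ _ IH | X D1 D2 A B D _ IH
    | D G A B _ IH1 _ IH2 | X D1 D2 A _ _ IH | X D1 D2 A B _ IH | Xi A _ IH
    | X D1 D2 A B _ IH | Xi A _ IH | X D1 D2 A C _ IH | X D1 D2 A Phi C _ IH
    | X D1 D2 A Phi C _ IH | Pi A X G1 G2 C _ _ IH1 _ IH2 | As B _ _ _ IH
    | X As G1 G2 G3 C _ _ _ IH | A B _ _ IH | X A G1 G2 G3 C _ _ _ IH ].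
  - intros w. apply msem_1E.
  - intros w Hw. red in Hw. simpl in Hw. subst w. apply below_refl.
  - apply (valid_at X D1 D2 (_ :: G) [TF C]); auto.
    intros w Hw. apply msem_cons in Hw as (a & b & -> & Ha & Hb).
    exists (a ++ b). split; [|apply below_refl]. apply msem_1I, Ha, IH1, Hb.
  - intros w Hw b Hb. apply IH. apply msem_app. exists w, b.
    repeat split; auto. now apply msem_1I.
  - rewrite (app_assoc G [_] D2 : G ++ TF (Under A C) :: D2 = _).
    apply (valid_at X D1 D2 _ [TF C]); auto.
    intros w Hw. apply msem_app in Hw as (a & b & -> & Ha & Hb).
    apply msem_1E in Hb.
    exists (a ++ b). split; [|apply below_refl]. apply msem_1I, Hb, IH1, Ha.
  - intros w Hw a Ha. apply IH. apply msem_cons. exists a, w. now repeat split.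
  - apply (valid_at X D1 D2 [_] [TF A; TF B]); auto.
    intros w Hw. apply msem_1E in Hw as (a & b & Ha & Hb & L).
    exists (a ++ b). split; auto. apply msem_cons. exists a, b.
    repeat split; auto. now apply msem_1I.
  - intros w Hw. apply msem_app in Hw as (a & b & -> & Ha & Hb).
    exists a, b. eauto using below_refl.
  - apply (valid_at X D1 D2 [_] []); auto.
    intros w Hw. apply msem_1E in Hw. exists []. split; auto. reflexivity.
  - apply (valid_at X D1 D2 [_] [TF A]); auto.
    intros w Hw. exists w. split; [|apply below_refl].
    apply msem_1E in Hw. exact Hw.
  - intros w Hw. apply IH. now apply msem_1I.
  - apply (valid_at X D1 D2 [_] [TB [TF A]]); auto.
    intros w Hw. exists w. split; [|apply below_refl].
    apply msem_1I, msem_1I. apply msem_1E in Hw. exact Hw.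
  - intros w Hw. apply msem_1E in Hw. now apply IH.
  - apply (valid_at X D1 D2 [_] [TF A]); auto.
    apply refines_formulas. intros w [L H]. now exists [].
  - rewrite (app_assoc Phi [_] D2 : Phi ++ TF (Bang A) :: D2 = _).
    apply (valid_at X D1 D2 _ (TF (Bang A) :: Phi)); auto using refines_bang_r.
  - apply (valid_at X D1 D2 (TF (Bang A) :: Phi) (Phi ++ [TF (Bang A)]));
      auto using refines_bang.
    now rewrite <- app_assoc.
  - apply (valid_at X G1 G2 Pi [TF A]); auto.
    intros w Hw. exists w. split; [|apply below_refl]. apply msem_1I. now apply IH1.
  - intros w Hw. apply msem_bangs in Hw as [L Hw]. split; auto.
  - apply (valid_refines _ (plug X (bangs As ++ G1 ++ TB (bangs As ++ G2) :: G3)));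
      auto.
    apply refines_plug. intros w Hw.
    apply msem_app in Hw as (a & w' & -> & Ha & Hw).
    apply msem_app in Hw as (g1 & w & -> & H1 & Hw).
    apply msem_app in Hw as (g2 & g3 & -> & H2 & H3).
    exists (a ++ g1 ++ g2 ++ g3). split; [|apply below_refl].
    apply msem_bangs in Ha as Ha'.
    apply msem_app. exists a, (g1 ++ g2 ++ g3). repeat split; auto.
    apply msem_app. exists g1, (g2 ++ g3). repeat split; auto.
    apply msem_cons. exists g2, g3. repeat split; auto.
    (* The copies inside the bracket are read as the empty word, so contraction leaves the word
       unchanged. *)
    apply (msem_app (bangs As) G2). exists [], g2. now repeat split.
  - intros w Hw. apply msem_1E in Hw as [L Hw]. split; auto.
    apply IH, msem_1I. split; auto using below_refl.
  - apply (valid_refines _ (plug X (TF (Bang A) :: G1 ++ TB (TF (Bang A) :: G2) :: G3)));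
      auto.
    apply refines_plug. intros w Hw.
    apply msem_cons in Hw as (a & w' & -> & Ha & Hw).
    apply msem_app in Hw as (g1 & w & -> & H1 & Hw).
    apply msem_cons in Hw as (g2 & g3 & -> & H2 & H3).
    exists (a ++ g1 ++ g2 ++ g3). split; [|apply below_refl].
    apply msem_cons. exists a, (g1 ++ g2 ++ g3).
    split; [reflexivity | split; [exact Ha|]].
    apply msem_app. exists g1, (g2 ++ g3). repeat split; auto.
    apply msem_cons. exists g2, g3. repeat split; auto.
    apply (msem_cons (TF (Bang A)) G2). exists [], g2.
    split; [|split]; [reflexivity | split; [apply below_refl | apply Ha]|].
    exact (msem_1E _ _ H2).
Qed.

End Model.

(** * Counter programs *)

(* [Loop r c] is "while r > 0 { r := r - 1; c }". *)
Inductive com : Type :=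
| Skip : com
| Inc  : nat -> com
| Loop : nat -> com -> com
| Seq  : com -> com -> com.

Definition store := nat -> nat.

Definition upd (s : store) (r n : nat) : store :=
  fun j => if j =? r then n else s j.

Inductive halts : list com -> store -> Prop :=
| h_nil : forall s, halts [] s
| h_skip : forall K s, halts K s -> halts (Skip :: K) s
| h_inc : forall r K s, halts K (upd s r (S (s r))) -> halts (Inc r :: K) s
| h_loop0 : forall r c K s,
    s r = 0 -> halts K s -> halts (Loop r c :: K) s
| h_loopS : forall r c K s m,
    s r = S m -> halts (c :: Loop r c :: K) (upd s r m) -> halts (Loop r c :: K) s
| h_seq : forall c1 c2 K s, halts (c1 :: c2 :: K) s -> halts (Seq c1 c2 :: K) s.

(* The equivalence carries both termination and determinism of [c] at [s]. *)
Definition runs (c : com) (s s' : store) : Prop :=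
  forall K, halts (c :: K) s <-> halts K s'.

Lemma runs_iff c s s' K : runs c s s' -> (halts (c :: K) s <-> halts K s').
Proof. now intros H. Qed.

Lemma halts_seq c1 c2 K s : halts (Seq c1 c2 :: K) s <-> halts (c1 :: c2 :: K) s.
Proof. split; intros H; [now inversion H | now constructor]. Qed.

Ltac store_eq :=
  apply functional_extensionality; intros ?j; unfold upd;
  repeat match goal with |- context [?a =? ?b] => destruct (Nat.eqb_spec a b) end;
  subst; auto; try lia; try congruence.

Lemma runs_eq c s s1 s2 : runs c s s1 -> s1 = s2 -> runs c s s2.
Proof. now intros H <-. Qed.

Lemma runs_skip s : runs Skip s s.
Proof. intros K. split; intros H; [now inversion H | now constructor]. Qed.

Lemma runs_inc r s : runs (Inc r) s (upd s r (S (s r))).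
Proof. intros K. split; intros H; [now inversion H | now constructor]. Qed.

Lemma runs_seq c1 c2 s s1 s2 :
  runs c1 s s1 -> runs c2 s1 s2 -> runs (Seq c1 c2) s s2.
Proof.
  intros H1 H2 K. rewrite <- (H2 K), <- (H1 (c2 :: K)).
  split; intros H; [now inversion H | now constructor].
Qed.

Lemma runs_loop0 r c s : s r = 0 -> runs (Loop r c) s s.
Proof.
  intros E K. split; intros H; [|now apply h_loop0].
  inversion H; subst; auto; congruence.
Qed.

Lemma halts_loopS r c s m K :
  s r = S m ->
  (halts (Loop r c :: K) s <-> halts (c :: Loop r c :: K) (upd s r m)).
Proof.
  intros E. split; intros H; [|now apply h_loopS with m].
  inversion H as [| | | | ? ? ? ? m' E' |]; subst; [congruence|].
  now replace m with m' by congruence.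
Qed.

Lemma runs_loopS r c s m s' s'' :
  s r = S m -> runs c (upd s r m) s' -> runs (Loop r c) s' s'' ->
  runs (Loop r c) s s''.
Proof.
  intros E H1 H2 K. now rewrite (halts_loopS r c s m K E), (H1 _), (H2 K).
Qed.

Definition clear (r : nat) : com := Loop r Skip.

Definition move (r a : nat) : com := Loop r (Inc a).

(** A loop empties the register it tests, so the value is transferred to both [a] and [t] and then
    restored from [t]. *)
Definition copy (r a t : nat) : com :=
  Seq (Loop r (Seq (Inc a) (Inc t))) (move t r).

Lemma runs_clear r s : runs (clear r) s (upd s r 0).
Proof.
  remember (s r) as m eqn:E. revert s E; induction m as [|m IH]; intros s E.
  - eapply runs_eq; [apply runs_loop0; auto | store_eq].
  - eapply runs_loopS; [eauto | apply runs_skip|].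
    eapply runs_eq; [apply IH | ]; [unfold upd; now rewrite Nat.eqb_refl | store_eq].
Qed.

Lemma runs_move r a s :
  r <> a -> runs (move r a) s (upd (upd s a (s a + s r)) r 0).
Proof.
  intros Hra.
  remember (s r) as m eqn:E. revert s E; induction m as [|m IH]; intros s E.
  - eapply runs_eq; [apply runs_loop0; auto | store_eq].
  - eapply runs_loopS; [eauto | apply runs_inc |].
    eapply runs_eq; [apply IH | store_eq]. unfold upd.
    rewrite Nat.eqb_refl. now destruct (Nat.eqb_spec r a).
Qed.

Lemma runs_copy r a t s :
  r <> a -> r <> t -> a <> t -> s t = 0 ->
  runs (copy r a t) s (upd s a (s a + s r)).
Proof.
  intros Hra Hrt Hat E0.
  assert (H : forall m s, s r = m ->
    runs (Loop r (Seq (Inc a) (Inc t))) s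
      (upd (upd (upd s a (s a + s r)) t (s t + s r)) r 0)).
  { clear - Hra Hrt Hat. induction m as [|m IH]; intros s E.
    - eapply runs_eq; [apply runs_loop0; auto | store_eq].
    - eapply runs_loopS; [eauto | eapply runs_seq; apply runs_inc |].
      eapply runs_eq; [apply IH | store_eq]; unfold upd;
        repeat match goal with
        |- context [?x =? ?y] => destruct (Nat.eqb_spec x y) end; try congruence; lia. }
  eapply runs_seq; [now apply H with (s r)|].
  eapply runs_eq; [apply runs_move; auto|].
  store_eq; rewrite ?Nat.eqb_refl;
    repeat match goal with
    |- context [?x =? ?y] => destruct (Nat.eqb_spec x y) end; try congruence; lia.
Qed.

(** * Compiling recursive functions *)

Fixpoint clear_range (n k : nat) : com :=
  match k with
  | 0 => Skip
  | S k => Seq (clear n) (clear_range (S n) k)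
  end.

(* The registers [args] are preserved; those from [n] on are scratch space,
   zero before and after the run. *)
Fixpoint compile (g : recf) (args : list nat) (out n : nat) : com :=
  match g with
  | RZero => Skip
  | RSucc =>
      match args with
      | [] => Inc out
      | a :: _ => Seq (copy a out n) (Inc out)
      end
  | RProj i =>
      match nth_error args i with
      | Some a => copy a out n
      | None => Skip
      end
  | RComp f gs =>
      let m := n + length gs in
      Seq ((fix go (gs : list recf) (i : nat) : com :=
              match gs with
              | [] => Skip
              | g :: gs => Seq (compile g args i m) (go gs (S i))
              end) gs n)
          (Seq (compile f (seq n (length gs)) out m) (clear_range n (length gs)))
  | RPrim f g =>
      match args with
      | [] => Skip
      | a :: rest =>
          let i := n in let r := 1 + n in let t := 2 + n in let d := 3 + n in
          let m := 4 + n in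
          Seq (copy a d m)
         (Seq (Seq (compile f rest r m)
                   (Loop d (Seq (compile g (i :: r :: rest) t m)
                           (Seq (clear r) (Seq (move t r) (Inc i))))))
              (Seq (clear i) (move r out)))
      end
  | RMu f =>
      let i := n in let t := 1 + n in let m := 2 + n in
      let step := compile f (i :: args) t m in
      Seq (Seq step (Loop t (Seq (clear t) (Seq (Inc i) step)))) (move i out)
  end.

(** A name for the anonymous inner fixpoint of [compile], to which it is convertible, so that
    induction over the list can be stated. *)
Definition compile_list (args : list nat) (m : nat) : list recf -> nat -> com :=
  fix go (gs : list recf) (i : nat) : com :=
    match gs with
    | [] => Skip
    | g :: gs => Seq (compile g args i m) (go gs (S i))
    end.

Definition compiles (g : recf) : Prop :=
  forall v y, eval g v y ->
  forall args out n s,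
    map s args = v -> Forall (fun a => a < n /\ a <> out) args -> out < n ->
    s out = 0 -> (forall j, n <= j -> s j = 0) ->
    runs (compile g args out n) s (upd s out y).

Lemma runs_clear_range n k s :
  runs (clear_range n k) s
    (fun j => if ((n <=? j) && (j <? n + k))%bool then 0 else s j).
Proof.
  revert n s; induction k as [|k IH]; intros n s; simpl.
  - eapply runs_eq; [apply runs_skip|].
    apply functional_extensionality; intros j.
    destruct (Nat.leb_spec n j), (Nat.ltb_spec j (n + 0)); simpl; auto; lia.
  - eapply runs_seq; [apply runs_clear|]. eapply runs_eq; [apply IH|].
    apply functional_extensionality; intros j. unfold upd.
    destruct (Nat.leb_spec n j), (Nat.ltb_spec j (n + S k)),
      (Nat.leb_spec (S n) j), (Nat.ltb_spec j (S n + k)), (Nat.eqb_spec j n);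
      simpl; auto; lia.
Qed.

Fixpoint upd_list (s : store) (i : nat) (ys : list nat) : store :=
  match ys with
  | [] => s
  | y :: ys => upd_list (upd s i y) (S i) ys
  end.

Lemma upd_same s r x : upd s r x r = x.
Proof. unfold upd. now rewrite Nat.eqb_refl. Qed.

Lemma upd_other s r x j : j <> r -> upd s r x j = s j.
Proof. unfold upd. now destruct (Nat.eqb_spec j r). Qed.

Lemma upd_list_out s i ys j :
  j < i \/ i + length ys <= j -> upd_list s i ys j = s j.
Proof.
  revert s i; induction ys as [|y ys IH]; simpl; intros s i H; auto.
  rewrite IH by lia. apply upd_other; lia.
Qed.

Lemma map_upd_list s i ys : map (upd_list s i ys) (seq i (length ys)) = ys.
Proof.
  revert s i; induction ys as [|y ys IH]; simpl; intros s i; auto.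
  f_equal; [|apply IH]. rewrite upd_list_out by lia. apply upd_same.
Qed.

Lemma map_store_ext (s s' : store) (P : nat -> Prop) args :
  Forall P args -> (forall a, P a -> s' a = s a) -> map s' args = map s args.
Proof.
  intros HF H. apply map_ext_in. intros a Ha. apply H.
  rewrite Forall_forall in HF. auto.
Qed.

Lemma runs_compile_list gs :
  Forall compiles gs ->
  forall v ys, evalL gs v ys ->
  forall args m i s,
    map s args = v -> Forall (fun a => a < i) args -> i + length gs <= m ->
    (forall j, i <= j -> s j = 0) ->
    runs (compile_list args m gs i) s (upd_list s i ys).
Proof.
  induction 1 as [|g gs Hg _ IH]; intros v ys E args m i s Hv Ha Hm Hs;
    inversion E; subst; simpl in *.
  - apply runs_skip.
  - eapply runs_seq.
    + eapply Hg; eauto; [|lia|intros; apply Hs; lia].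
      eapply Forall_impl; [|exact Ha]. simpl; lia.
    + eapply IH; eauto; [| |lia|].
      * eapply map_store_ext; [exact Ha|]. simpl. intros. apply upd_other. lia.
      * eapply Forall_impl; [|exact Ha]. simpl; lia.
      * intros j Hj. rewrite upd_other by lia. apply Hs. lia.
Qed.

Lemma evalL_length gs v ys : evalL gs v ys -> length ys = length gs.
Proof. induction 1; simpl; auto. Qed.

Lemma compiles_comp f gs : compiles f -> Forall compiles gs -> compiles (RComp f gs).
Proof.
  intros Hf Hgs v y E args out n s Hv Ha Ho H0 Hs.
  inversion E as [| | |f' gs' v' ys y' EL Ef| | |]; subst.
  pose proof (evalL_length _ _ _ EL) as Hlen.
  eapply runs_seq; [|eapply runs_seq].
  - apply (runs_compile_list gs Hgs _ ys EL args (n + length gs) n s); auto.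
    eapply Forall_impl; [|exact Ha]. simpl; lia.
  - eapply Hf; [exact Ef| | | | |].
    + rewrite <- Hlen. apply map_upd_list.
    + apply Forall_forall. intros a Hin. apply in_seq in Hin. lia.
    + lia.
    + rewrite upd_list_out by lia. exact H0.
    + intros j Hj. rewrite upd_list_out by lia. apply Hs. lia.
  - eapply runs_eq; [apply runs_clear_range|].
    apply functional_extensionality; intros j. simpl.
    destruct (Nat.leb_spec n j), (Nat.ltb_spec j (n + length gs)); simpl.
    + rewrite upd_other by lia. rewrite Hs; lia.
    + unfold upd. destruct (Nat.eqb_spec j out); auto. apply upd_list_out; lia.
    + unfold upd. destruct (Nat.eqb_spec j out); auto. apply upd_list_out; lia.
    + lia.
Qed.

Ltac upd_simp :=
  repeat first [rewrite upd_same | rewrite upd_other by lia].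

(** Evaluation descends on the recursion argument while the loop counts [i] upwards. The invariant
    therefore has a slack [k]: starting with [M + k] rounds due in [d], the loop reaches [i = M] and
    the value at [M] in [r], with [k] rounds left. The case [S M] with slack [k] uses the hypothesis
    for [M] with slack [S k]. *)
Lemma compiles_prim f g : compiles f -> compiles g -> compiles (RPrim f g).
Proof.
  intros Hf Hg v y E args out n s Hv Ha Ho H0 Hs.
  destruct args as [|a rest]; simpl in Hv; [subst v; inversion E|].
  inversion Ha as [|? ? [Han Hao] Hrest]; subst. simpl compile.
  set (m := S (S (S (S n)))). set (d := S (S (S n))). set (t := S (S n)).
  set (r := S n). set (i := n).
  set (body := Seq (compile g (i :: r :: rest) t m)
                  (Seq (clear r) (Seq (move t r) (Inc i)))).
  assert (Hloop : forall M y, eval (RPrim f g) (M :: map s rest) y ->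
    forall k K,
      halts (compile f rest r m :: Loop d body :: K) (upd s d (M + k)) <->
      halts (Loop d body :: K) (upd (upd (upd s i M) r y) d k)).
  { clear y E. induction M as [|M IH]; intros y E k K.
    - inversion E as [| | | |f' g' v' y' Ef| |]; subst. simpl Nat.add.
      apply runs_iff. eapply runs_eq; [eapply (Hf _ _ Ef)|].
      + eapply map_store_ext; [exact Hrest|]. simpl. intros.
        apply upd_other. unfold d. lia.
      + eapply Forall_impl; [|exact Hrest]. simpl. unfold m, r. lia.
      + unfold m, r. lia.
      + unfold r, d. upd_simp. apply Hs. lia.
      + unfold m, d. intros. upd_simp. apply Hs. lia.
      + unfold i, r, d. store_eq; rewrite Hs; lia.
    - inversion E as [| | | | |f' g' M' v' x y' Ex Eg|]; subst.
      replace (S M + k) with (M + S k) by lia.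
      rewrite (IH x Ex (S k) K).
      rewrite (halts_loopS d body _ k) by apply upd_same.
      enough (R : runs body (upd (upd (upd (upd s i M) r x) d (S k)) d k)
        (upd (upd (upd s i (S M)) r y) d k)) by apply R.
      eapply runs_seq; [|eapply runs_seq; [apply runs_clear|
        eapply runs_seq; [apply runs_move|
          eapply runs_eq; [apply runs_inc|]]]].
      + eapply (Hg _ _ Eg).
        * simpl map. unfold i, r, d. upd_simp. do 2 f_equal.
          eapply map_store_ext; [exact Hrest|]. simpl. intros. now upd_simp.
        * unfold i, r, t, m. repeat constructor; try lia.
          eapply Forall_impl; [|exact Hrest]. simpl. lia.
        * unfold t, m. lia.
        * unfold i, r, d, t. upd_simp. apply Hs. lia.
        * unfold i, r, d, m. intros. upd_simp. apply Hs. lia.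
      + unfold t, r. lia.
      + unfold i, r, t, d. upd_simp.
        apply functional_extensionality; intros j.
        destruct (Nat.eq_dec j n) as [->|]; [now upd_simp|].
        destruct (Nat.eq_dec j (S n)) as [->|]; [now upd_simp|].
        destruct (Nat.eq_dec j (S (S n))) as [->|];
          [upd_simp; symmetry; apply Hs; lia|].
        destruct (Nat.eq_dec j (S (S (S n)))) as [->|]; now upd_simp. }
  eapply runs_seq.
  { apply runs_copy; unfold d, m; try lia. apply Hs. lia. }
  intros K.
  do 2 rewrite halts_seq.
  replace (s d + s a) with (s a + 0) by (rewrite (Hs d); unfold d; lia).
  rewrite (Hloop _ _ E 0).
  rewrite (runs_iff _ _ _ _ (runs_loop0 d body _ (upd_same _ _ _))).
  apply runs_iff. eapply runs_seq; [apply runs_clear|].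
  eapply runs_eq; [apply runs_move; unfold r; lia|].
  unfold i, r, d. upd_simp. rewrite H0.
  apply functional_extensionality; intros j.
  destruct (Nat.eq_dec j out) as [->|]; [now upd_simp|].
  destruct (Nat.eq_dec j n) as [->|]; [upd_simp; symmetry; apply Hs; lia|].
  destruct (Nat.eq_dec j (S n)) as [->|]; [upd_simp; symmetry; apply Hs; lia|].
  destruct (Nat.eq_dec j (S (S (S n)))) as [->|];
    [upd_simp; symmetry; apply Hs; lia|].
  now upd_simp.
Qed.

(** Below the minimum [y] the tested value is positive, so the loop is entered, [t] is cleared and
    [i] advances. Hence starting at [i = 0] is equivalent to starting at any [j <= y], and at [y]
    the loop is left. *)
Lemma compiles_mu f : compiles f -> compiles (RMu f).
Proof.
  intros Hf v y E args out n s Hv Ha Ho H0 Hs.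
  inversion E as [| | | | | |f' v' y' E0 ES]; subst. simpl compile.
  set (m := S (S n)). set (t := S n). set (i := n).
  set (step := compile f (i :: args) t m).
  set (body := Seq (clear t) (Seq (Inc i) step)).
  assert (Hstep : forall j z, eval f (j :: map s args) z ->
    runs step (upd s i j) (upd (upd s i j) t z)).
  { intros j z Ez. eapply (Hf _ _ Ez).
    - simpl. unfold i. upd_simp. f_equal.
      eapply map_store_ext; [exact Ha|]. simpl. intros. now upd_simp.
    - unfold i, t, m. constructor; [lia|].
      eapply Forall_impl; [|exact Ha]. simpl. lia.
    - unfold t, m. lia.
    - unfold t, i. upd_simp. apply Hs. lia.
    - unfold m, i. intros. upd_simp. apply Hs. lia. }
  assert (Hloop : forall K j, j <= y ->
    (halts (step :: Loop t body :: K) s <->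
     halts (step :: Loop t body :: K) (upd s i j))).
  { intros K. induction j as [|j IH]; intros Hj.
    - replace (upd s i 0) with s; [reflexivity|].
      unfold i. store_eq.
    - rewrite IH by lia. destruct (ES j) as [k Ek]; [lia|].
      rewrite (runs_iff _ _ _ _ (Hstep j _ Ek)).
      rewrite (halts_loopS t body _ k) by apply upd_same.
      unfold body at 1. set (L := Loop t body :: K).
      rewrite halts_seq, (runs_iff _ _ _ _ (runs_clear _ _)), halts_seq,
        (runs_iff _ _ _ _ (runs_inc _ _)).
      match goal with |- _ ?a <-> _ ?b => replace a with b; [reflexivity|] end.
      unfold i, t. upd_simp.
      apply functional_extensionality; intros x.
      destruct (Nat.eq_dec x n) as [->|]; [now upd_simp|].
      destruct (Nat.eq_dec x (S n)) as [->|]; [upd_simp; apply Hs; lia|].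
      now upd_simp. }
  intros K.
  do 2 rewrite halts_seq. rewrite (Hloop _ y (le_n y)), (runs_iff _ _ _ _ (Hstep y 0 E0)).
  rewrite (runs_iff _ _ _ _ (runs_loop0 t body _ (upd_same _ _ _))).
  apply runs_iff. eapply runs_eq; [apply runs_move; unfold i; lia|].
  unfold i, t. upd_simp. rewrite H0.
  apply functional_extensionality; intros j.
  destruct (Nat.eq_dec j out) as [->|]; [now upd_simp|].
  destruct (Nat.eq_dec j n) as [->|]; [upd_simp; symmetry; apply Hs; lia|].
  destruct (Nat.eq_dec j (S n)) as [->|]; [upd_simp; symmetry; apply Hs; lia|].
  now upd_simp.
Qed.

Lemma compile_correct : forall g, compiles g.
Proof.
  (* [recf] is nested in lists, and its generated induction principle says nothing about the members
     of [gs]; the recursion is done by hand. *)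
  fix IH 1. intros [| |i|f gs|f g|f].
  - intros v y E args out n s Hv Ha Ho H0 Hs. inversion E; subst.
    eapply runs_eq; [apply runs_skip | store_eq].
  - intros v y E args out n s Hv Ha Ho H0 Hs. inversion E; subst.
    destruct args as [|a args]; simpl.
    + eapply runs_eq; [apply runs_inc | now rewrite H0].
    + inversion Ha as [|? ? [Han Hao] _]; subst.
      eapply runs_seq; [apply runs_copy; try lia; apply Hs; lia|].
      eapply runs_eq; [apply runs_inc | rewrite upd_same, H0; store_eq].
  - intros v y E args out n s Hv Ha Ho H0 Hs. inversion E; subst. simpl.
    destruct (nth_error args i) as [a|] eqn:Ei.
    + rewrite Forall_forall in Ha.
      destruct (Ha a) as [Han Hao]; [eapply nth_error_In; eauto|].
      eapply runs_eq; [apply runs_copy; try lia; apply Hs; lia|].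
      rewrite H0. f_equal. symmetry. apply nth_error_nth.
      rewrite nth_error_map, Ei. reflexivity.
    + rewrite nth_overflow by (rewrite length_map; now apply nth_error_None).
      eapply runs_eq; [apply runs_skip | store_eq].
  - apply compiles_comp; [apply IH|].
    induction gs as [|g gs IHgs]; constructor; [apply IH | exact IHgs].
  - apply compiles_prim; apply IH.
  - apply compiles_mu; apply IH.
Qed.

(** * Counter programs as string rewriting *)

(* A configuration is the word [LM l (Hd false K) r RM], where [K] is the rest
   of the program and register [j] holds the number of occurrences of [Reg j]
   in [l] and [r]. The head [Hd true K] is looking for a counterexample to the
   emptiness of the loop register of [K], from left to right. *)
Inductive letter : Type :=
| LM  : letter
| RM  : letter
| Reg : nat -> letter
| Hd  : bool -> list com -> letter.

Inductive rule : Type :=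
  Rule : list letter -> letter -> list letter ->
         list letter -> letter -> list letter -> rule.

Definition lhs (R : rule) : list letter :=
  let (u, h, v, _, _, _) := R in u ++ h :: v.

Definition rhs (R : rule) : list letter :=
  let (_, _, _, u, h, v) := R in u ++ h :: v.

(** Free movement in both directions makes the order of register letters immaterial. The scanning
    head gets no such moves, as it must not step back or skip letters. *)
Definition moves (N : nat) (K : list com) : list rule :=
  flat_map (fun j =>
    [Rule [] (Hd false K) [Reg j] [Reg j] (Hd false K) [];
     Rule [Reg j] (Hd false K) [] [] (Hd false K) [Reg j]]) (seq 0 N).

(** A loop is left only by a scan from [LM] to [RM], and no rule takes the scanning head past its
    own [Reg r]; a wrongly guessed exit gets stuck. The final head erases registers, so that all
    halting runs can end in one and the same word. *)
Definition steps (N : nat) (K : list com) : list rule :=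
  match K with
  | [] => map (fun j => Rule [] (Hd false []) [Reg j] [] (Hd false []) []) (seq 0 N)
  | Skip :: K' => [Rule [] (Hd false K) [] [] (Hd false K') []]
  | Inc r :: K' => [Rule [] (Hd false K) [] [Reg r] (Hd false K') []]
  | Seq c1 c2 :: K' => [Rule [] (Hd false K) [] [] (Hd false (c1 :: c2 :: K')) []]
  | Loop r c :: K' =>
      [Rule [] (Hd false K) [Reg r] [] (Hd false (c :: K)) [];
       Rule [LM] (Hd false K) [] [LM] (Hd true K) [];
       Rule [] (Hd true K) [RM] [] (Hd false K') [RM]] ++
      map (fun j => Rule [] (Hd true K) [Reg j] [Reg j] (Hd true K) [])
        (filter (fun j => negb (j =? r)) (seq 0 N))
  end.

Definition rules (N : nat) (Ks : list (list com)) : list rule :=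
  flat_map (fun K => moves N K ++ steps N K) Ks.

(** * Safe words and their closure under reverse rewriting *)

Definition is_reg (x : letter) : bool := match x with Reg _ => true | _ => false end.

Definition wf_left (l : list letter) : bool :=
  match l with LM :: l => forallb is_reg l | _ => false end.

Fixpoint wf_right (r : list letter) : bool :=
  match r with
  | [RM] => true
  | Reg _ :: r => wf_right r
  | _ => false
  end.

Fixpoint cnt (w : list letter) (j : nat) : nat :=
  match w with
  | [] => 0
  | Reg i :: w => (if j =? i then 1 else 0) + cnt w j
  | _ :: w => cnt w j
  end.

Lemma cnt_app u v j : cnt (u ++ v) j = cnt u j + cnt v j.
Proof. induction u as [|[] u IH]; simpl; auto; lia. Qed.

Definition scanned (z : bool) (K : list com) (l : list letter) : Prop :=
  z = true -> forall i c K', K = Loop i c :: K' -> cnt l i = 0.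

(** This is the language [P] of the model. Words that are not proper configurations are vacuously
    safe, because [below] puts rules into arbitrary contexts, including senseless ones. *)
Definition safe (w : list letter) : Prop :=
  forall l z K r, w = l ++ Hd z K :: r ->
  wf_left l = true -> wf_right r = true -> scanned z K l ->
  halts K (fun j => cnt l j + cnt r j).

Definition not_head (x : letter) : Prop := forall z K, x <> Hd z K.

Lemma wf_left_not_head l : wf_left l = true -> Forall not_head l.
Proof.
  destruct l as [|[] l]; try discriminate. simpl. rewrite forallb_forall.
  intros H. constructor; [easy|].
  apply Forall_forall. intros x Hx z K ->. now apply H in Hx.
Qed.

Lemma wf_right_not_head r : wf_right r = true -> Forall not_head r.
Proof.
  induction r as [|[| | |] r IH]; simpl; intros H; try discriminate.
  - constructor; [easy|]. destruct r; [constructor | discriminate].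
  - constructor; [easy | auto].
Qed.

Lemma unique_head l r l0 z K r0 z0 K0 :
  Forall not_head l -> Forall not_head r ->
  l0 ++ Hd z0 K0 :: r0 = l ++ Hd z K :: r ->
  l0 = l /\ z0 = z /\ K0 = K /\ r0 = r.
Proof.
  intros Hl Hr. revert l0; induction Hl as [|x l Hx Hl IH]; intros [|y l0] E;
    simpl in E; inversion E; subst; auto.
  - rewrite Forall_forall in Hr. exfalso.
    apply (Hr (Hd z0 K0)) with z0 K0; auto. apply in_elt.
  - exfalso. now apply (Hx z0 K0).
  - destruct (IH l0) as (-> & ? & ? & ?); auto.
Qed.

(** A well-formed word has only one head, so a rule that matches there matches at that head. Closure
    thus reduces to a check on the two parts beside it. *)
Lemma safe_back u z K v u' z' K' v' :
  (forall l r, wf_left (l ++ u) = true -> wf_right (v ++ r) = true ->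
     scanned z K (l ++ u) ->
     wf_left (l ++ u') = true /\ wf_right (v' ++ r) = true /\
     scanned z' K' (l ++ u') /\
     (halts K' (fun j => cnt (l ++ u') j + cnt (v' ++ r) j) ->
      halts K (fun j => cnt (l ++ u) j + cnt (v ++ r) j))) ->
  forall l r,
    safe (l ++ (u' ++ Hd z' K' :: v') ++ r) -> safe (l ++ (u ++ Hd z K :: v) ++ r).
Proof.
  intros H l r Hs l1 z1 K1 r1 E Hl Hr Hz.
  rewrite <- app_assoc, app_assoc in E. simpl in E.
  apply unique_head in E as (<- & <- & <- & <-);
    auto using wf_left_not_head, wf_right_not_head.
  destruct (H l r Hl Hr Hz) as (Hl' & Hr' & Hz' & Hh).
  apply Hh, (Hs _ z'); auto. now rewrite <- !app_assoc.
Qed.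

Lemma wf_left_Reg l j : wf_left (l ++ [Reg j]) = wf_left l.
Proof.
  destruct l as [|[] l]; simpl; auto.
  rewrite forallb_app. simpl. apply Bool.andb_true_r.
Qed.

Lemma wf_left_LM l : wf_left (l ++ [LM]) = true -> l = [].
Proof.
  destruct l as [|[] l]; simpl; try discriminate; auto.
  rewrite forallb_app. simpl. now rewrite Bool.andb_false_r.
Qed.

Lemma halts_ext K s s' : (forall j, s j = s' j) -> halts K s -> halts K s'.
Proof. intros E. now replace s' with s by now apply functional_extensionality. Qed.

Ltac counts :=
  intros; unfold upd; simpl; rewrite ?app_nil_r, ?cnt_app; simpl;
  repeat match goal with |- context [?a =? ?b] => destruct (Nat.eqb_spec a b) end;
  subst; simpl; try lia; try congruence.

Lemma rules_back N Ks R :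
  In R (rules N Ks) ->
  forall l r, safe (l ++ rhs R ++ r) -> safe (l ++ lhs R ++ r).
Proof.
  intros HR. apply in_flat_map in HR as (K & _ & HR).
  apply in_app_or in HR as [HR|HR].
  - apply in_flat_map in HR as (j & _ & [<-|[<-|[]]]); apply safe_back;
      intros l r Hl Hr Hz; rewrite ?app_nil_r, ?wf_left_Reg in *; simpl in *;
      repeat split; auto; try discriminate; apply halts_ext; counts.
  - destruct K as [|[|i|i c|c1 c2] K].
    + apply in_map_iff in HR as (j & <- & _). apply safe_back.
      intros l r Hl Hr Hz; rewrite ?app_nil_r in *; simpl in *.
      repeat split; auto; try discriminate. intros; constructor.
    + destruct HR as [<-|[]]. apply safe_back.
      intros l r Hl Hr Hz; rewrite ?app_nil_r in *; simpl in *.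
      repeat split; auto; try discriminate. now constructor.
    + destruct HR as [<-|[]]. apply safe_back.
      intros l r Hl Hr Hz; rewrite ?app_nil_r, ?wf_left_Reg in *; simpl in *.
      repeat split; auto; try discriminate. intros H. constructor.
      revert H. apply halts_ext. counts.
    + apply in_app_or in HR as [[<-|[<-|[<-|[]]]]|HR].
      * apply safe_back.
        intros l r Hl Hr Hz; rewrite ?app_nil_r in *; simpl in *.
        repeat split; auto; try discriminate. intros H.
        apply h_loopS with (cnt l i + cnt r i); [counts|].
        revert H. apply halts_ext. counts.
      * apply safe_back.
        (* The marker can only be the first letter, so the scan starts with no register on its left
           and [scanned] holds. *)
        intros l r Hl Hr Hz. apply wf_left_LM in Hl as Hl'. subst l.
        repeat split; auto.
      * apply safe_back.
        intros l r Hl Hr Hz; rewrite ?app_nil_r in *; simpl in *.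
        repeat split; auto; try discriminate. intros H. apply h_loop0.
        (* The left part has been scanned and the right part is just [RM], so the register is indeed
           0. *)
        -- rewrite (Hz eq_refl i c K eq_refl). now destruct r.
        -- exact H.
      * apply in_map_iff in HR as (j & <- & HR).
        apply filter_In in HR as [_ HR]. apply safe_back.
        intros l r Hl Hr Hz; rewrite ?app_nil_r, ?wf_left_Reg in *; simpl in *.
        repeat split; auto.
        -- intros _ i' c' K' E. inversion E; subst. rewrite cnt_app.
           rewrite (Hz eq_refl i' c' K' eq_refl). simpl. rewrite Nat.eqb_sym.
           now destruct (j =? i').
        -- apply halts_ext. counts.
    + destruct HR as [<-|[]]. apply safe_back.
      intros l r Hl Hr Hz; rewrite ?app_nil_r in *; simpl in *.
      repeat split; auto; try discriminate. now constructor.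
Qed.

(** The stacks that can arise while [c] runs on top of [K]. They are finitely many since a loop body
    always runs on the same stack, the loop itself over [K]. *)
Fixpoint conts (c : com) (K : list com) : list (list com) :=
  (c :: K) ::
  match c with
  | Skip | Inc _ => []
  | Loop _ d => conts d (c :: K)
  | Seq c1 c2 => conts c1 (c2 :: K) ++ conts c2 K
  end.

Definition next (K : list com) : list (list com) :=
  match K with
  | [] => []
  | Skip :: K' | Inc _ :: K' => [K']
  | Loop _ c :: K' => [c :: K; K']
  | Seq c1 c2 :: K' => [c1 :: c2 :: K']
  end.

Lemma conts_self c K : In (c :: K) (conts c K).
Proof. destruct c; now left. Qed.

Lemma conts_next c K0 K K' :
  In K (conts c K0) -> In K' (next K) -> K' = K0 \/ In K' (conts c K0).
Proof.
  revert K0; induction c as [|r|r c IH|c1 IH1 c2 IH2]; intros K0 HK HK';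
    destruct HK as [<-|HK].
  - destruct HK' as [<-|[]]; auto.
  - destruct HK.
  - destruct HK' as [<-|[]]; auto.
  - destruct HK.
  - destruct HK' as [<-|[<-|[]]]; auto. right. right. apply conts_self.
  - right. destruct (IH _ HK HK') as [->|]; [now left | now right].
  - destruct HK' as [<-|[]]. right. right. apply in_or_app. left. apply conts_self.
  - apply in_app_or in HK as [HK|HK].
    + right. right. apply in_or_app.
      destruct (IH1 _ HK HK') as [->|]; auto using conts_self.
    + destruct (IH2 _ HK HK') as [->|]; auto.
      right. right. apply in_or_app. auto.
Qed.

Fixpoint bound (c : com) : nat :=
  match c with
  | Skip => 0
  | Inc r => S r
  | Loop r c => Nat.max (S r) (bound c)
  | Seq c1 c2 => Nat.max (bound c1) (bound c2)
  end.

Lemma conts_bound c K0 N K :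
  bound c <= N -> Forall (fun c => bound c <= N) K0 ->
  In K (conts c K0) -> Forall (fun c => bound c <= N) K.
Proof.
  revert K0; induction c as [|r|r c IH|c1 IH1 c2 IH2]; intros K0 Hc H0 HK;
    (destruct HK as [<-|HK]; [now constructor|]); cbn [bound] in Hc.
  - destruct HK.
  - destruct HK.
  - apply (IH (Loop r c :: K0)); [lia | constructor; auto | exact HK].
  - apply in_app_or in HK as [HK|HK].
    + apply (IH1 (c2 :: K0)); [lia | constructor; [lia|exact H0] | exact HK].
    + apply (IH2 K0); [lia | exact H0 | exact HK].
Qed.

(** * Halting runs followed by rewriting *)

Section Simulation.

Context (N : nat) (Ks : list (list com)) (G : list letter -> Prop)
  (Ks_next : forall K K', In K Ks -> In K' (next K) -> In K' Ks)
  (Ks_bound : forall K, In K Ks -> Forall (fun c => bound c <= N) K)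
  (G_rules : forall R, In R (rules N Ks) ->
    forall l r, G (l ++ rhs R ++ r) -> G (l ++ lhs R ++ r))
  (G_final : G [LM; Hd false []; RM]).

Definition config (l : list nat) (z : bool) (K : list com) (r : list nat) :=
  LM :: map Reg l ++ Hd z K :: map Reg r ++ [RM].

Lemma G_local R l r z K l' r' z' K' u u' :
  In R (rules N Ks) ->
  config l z K r = u ++ lhs R ++ u' -> config l' z' K' r' = u ++ rhs R ++ u' ->
  G (config l' z' K' r') -> G (config l z K r).
Proof. intros HR -> ->. apply (G_rules R HR). Qed.

Lemma in_rules K R : In K Ks -> In R (moves N K ++ steps N K) -> In R (rules N Ks).
Proof. intros HK HR. apply in_flat_map. eauto. Qed.

Ltac config_eq :=
  unfold config; rewrite ?map_app; simpl; rewrite <- ?app_assoc; reflexivity.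

Lemma G_left l j K r :
  In K Ks -> j < N ->
  (G (config (l ++ [j]) false K r) <-> G (config l false K (j :: r))).
Proof.
  intros HK Hj.
  assert (HR : forall R, In R [Rule [] (Hd false K) [Reg j] [Reg j] (Hd false K) [];
    Rule [Reg j] (Hd false K) [] [] (Hd false K) [Reg j]] -> In R (rules N Ks)).
  { intros R HR. apply (in_rules K); auto. apply in_or_app. left.
    apply in_flat_map. exists j. split; auto. apply in_seq. lia. }
  split.
  - apply (G_local _ _ _ _ _ _ _ _ _ (LM :: map Reg l) (map Reg r ++ [RM])
      (HR _ (or_introl eq_refl))); config_eq.
  - apply (G_local _ _ _ _ _ _ _ _ _ (LM :: map Reg l) (map Reg r ++ [RM])
      (HR _ (or_intror (or_introl eq_refl)))); config_eq.
Qed.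

Lemma G_start l K r :
  In K Ks -> Forall (fun j => j < N) l ->
  (G (config l false K r) <-> G (config [] false K (l ++ r))).
Proof.
  intros HK. revert r; induction l as [|j l IH] using rev_ind; intros r Hl.
  - reflexivity.
  - apply Forall_app in Hl as [Hl Hj]. inversion Hj; subst.
    rewrite G_left, IH, <- app_assoc by auto. reflexivity.
Qed.

(** Each program step is matched by chosen rewriting steps, taken in reverse: [G] passes from the
    later configuration to the earlier one. Any listing [w] of the registers is allowed, since their
    order changes during a run. *)
Lemma halts_G K s :
  halts K s -> In K Ks -> forall w,
  Forall (fun j => j < N) w -> (forall j, count_occ Nat.eq_dec w j = s j) ->
  G (config [] false K w).
Proof.
  induction 1 as [s|K s _ IH|r K s _ IH|r c K s E _ IH|r c K s m E _ IH|c1 c2 K s _ IH];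
    intros HK w Hw Hs.
  - clear Hs. induction Hw as [|j w Hj Hw IH]; [exact G_final|].
    apply (G_local (Rule [] (Hd false []) [Reg j] [] (Hd false []) [])
      _ _ _ _ [] w false [] [LM] (map Reg w ++ [RM])); auto; try config_eq.
    apply (in_rules []); auto. apply in_or_app. right.
    apply (in_map (fun j => Rule [] (Hd false []) [Reg j] [] (Hd false []) [])).
    apply in_seq. lia.
  - assert (HK' : In K Ks) by (apply (Ks_next _ _ HK); now left).
    apply (G_local (Rule [] (Hd false (Skip :: K)) [] [] (Hd false K) [])
      _ _ _ _ [] w false K [LM] (map Reg w ++ [RM])); auto; try config_eq.
    apply (in_rules _ _ HK), in_or_app. right. now left.
  - assert (HK' : In K Ks) by (apply (Ks_next _ _ HK); now left).
    apply (G_local (Rule [] (Hd false (Inc r :: K)) [] [Reg r] (Hd false K) [])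
      _ _ _ _ [r] w false K [LM] (map Reg w ++ [RM])); try config_eq.
    + apply (in_rules _ _ HK), in_or_app. right. now left.
    + apply Ks_bound in HK as HB. inversion HB as [|? ? Hr _]; subst. simpl in Hr.
      apply G_start; auto. apply IH; auto; [now constructor|].
      intros j. unfold upd. simpl.
      destruct (Nat.eq_dec r j), (Nat.eqb_spec j r); subst; auto; congruence.
  - assert (HK' : In K Ks) by (apply (Ks_next _ _ HK); now right; left).
    assert (Hr : ~ In r w).
    { intros Hin. apply (count_occ_In Nat.eq_dec) in Hin. rewrite Hs in Hin. lia. }
    set (L := Loop r c :: K) in *.
    apply (G_local (Rule [LM] (Hd false L) [] [LM] (Hd true L) [])
      _ _ _ _ [] w true L [] (map Reg w ++ [RM])); auto; try config_eq.
    { apply (in_rules _ _ HK), in_or_app. right. simpl. auto. }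
    (* Generalised over the position of the scanning head: [w1] has been passed, [w2] is still to
       come. *)
    assert (Hscan : forall w2 w1, w1 ++ w2 = w ->
      G (config w false K []) -> G (config w1 true L w2)).
    { induction w2 as [|j w2 IHw]; intros w1 Ew.
      - rewrite app_nil_r in Ew. subst w1. apply (G_local (Rule [] (Hd true L) [RM] [] (Hd false K) [RM])
        _ _ _ _ w [] false K (LM :: map Reg w) []); try config_eq.
        apply (in_rules _ _ HK), in_or_app. right. simpl. auto.
      - intros HG.
        assert (Hin : In j w) by (rewrite <- Ew; apply in_elt).
        apply (G_local (Rule [] (Hd true L) [Reg j] [Reg j] (Hd true L) [])
          _ _ _ _ (w1 ++ [j]) w2 true L (LM :: map Reg w1) (map Reg w2 ++ [RM]));
          try config_eq.
        + apply (in_rules _ _ HK), in_or_app. right. apply in_or_app. right.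
          apply (in_map (fun j => Rule [] (Hd true L) [Reg j] [Reg j] (Hd true L) [])).
          apply filter_In. rewrite Forall_forall in Hw. specialize (Hw j Hin).
          split; [apply in_seq; lia|].
          destruct (Nat.eqb_spec j r) as [->|]; auto.
        + apply IHw; auto. now rewrite <- app_assoc. }
    apply Hscan; auto. apply G_start; auto. rewrite app_nil_r. auto.
  - assert (HK' : In (c :: Loop r c :: K) Ks) by (apply (Ks_next _ _ HK); now left).
    assert (Hin : In r w).
    { apply (count_occ_In Nat.eq_dec). rewrite Hs. lia. }
    apply in_split in Hin as (w1 & w2 & ->).
    apply Forall_app in Hw as [Hw1 Hw2]. inversion Hw2; subst.
    apply (G_start w1); auto.
    apply (G_local (Rule [] (Hd false (Loop r c :: K)) [Reg r]
                         [] (Hd false (c :: Loop r c :: K)) [])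
      _ _ _ _ w1 w2 false (c :: Loop r c :: K) (LM :: map Reg w1) (map Reg w2 ++ [RM]));
      try config_eq.
    + apply (in_rules _ _ HK), in_or_app. right. simpl. auto.
    + apply G_start; auto. apply IH; auto; [now apply Forall_app|].
      intros j. specialize (Hs j). rewrite count_occ_app in *. simpl in Hs.
      unfold upd. destruct (Nat.eq_dec r j), (Nat.eqb_spec j r); subst; try congruence.
      lia.
  - assert (HK' : In (c1 :: c2 :: K) Ks) by (apply (Ks_next _ _ HK); now left).
    apply (G_local (Rule [] (Hd false (Seq c1 c2 :: K)) [] [] (Hd false (c1 :: c2 :: K)) [])
      _ _ _ _ [] w false (c1 :: c2 :: K) [LM] (map Reg w ++ [RM])); auto; try config_eq.
    apply (in_rules _ _ HK), in_or_app. right. now left.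
Qed.

End Simulation.

(** Needed twice: the consumed middle letter is a head, hence has the form on which contraction
    acts, and all heads carry stacks from [Ks], so that [decode] inverts [encode] on the rule. *)
Lemma in_rules_inv N Ks R :
  (forall K K', In K Ks -> In K' (next K) -> In K' Ks) ->
  In R (rules N Ks) ->
  let (u, h, v, u', h', v') := R in
  (exists z K, h = Hd z K) /\
  (forall z K, In (Hd z K) (u ++ h :: v ++ u' ++ h' :: v') -> In K Ks).
Proof.
  intros Hnext HR. apply in_flat_map in HR as (K & HK & HR).
  specialize (fun K' => Hnext K K' HK).
  assert (Hconc : exists j k z K',
    let (u, h, v, u', h', v') := R in
    incl (u ++ h :: v ++ u' ++ h' :: v') [LM; RM; Reg j; Reg k; Hd false K; Hd true K; Hd z K']
    /\ (exists z K, h = Hd z K) /\ In K' (K :: next K)).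
  { apply in_app_or in HR as [HR|HR].
    - apply in_flat_map in HR as (j & _ & [<-|[<-|[]]]);
        exists j, j, true, K; repeat split; eauto; try (now left);
        intros x; simpl; tauto.
    - destruct K as [|[|i|i c|c1 c2] K].
      + apply in_map_iff in HR as (j & <- & _).
        exists j, j, true, []; repeat split; eauto; try (now left); intros x; simpl; tauto.
      + destruct HR as [<-|[]].
        exists 0, 0, false, K; repeat split; eauto; try (now right; left); intros x; simpl; tauto.
      + destruct HR as [<-|[]].
        exists i, i, false, K; repeat split; eauto; try (now right; left); intros x; simpl; tauto.
      + apply in_app_or in HR as [[<-|[<-|[<-|[]]]]|HR].
        * exists i, i, false, (c :: Loop i c :: K).
          repeat split; eauto; try (now right; left); intros x; simpl; tauto.
        * exists i, i, true, (Loop i c :: K).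
          repeat split; eauto; try (now left); intros x; simpl; tauto.
        * exists i, i, false, K.
          repeat split; eauto; try (now right; right; left); intros x; simpl; tauto.
        * apply in_map_iff in HR as (j & <- & _).
          exists j, j, true, (Loop i c :: K).
          repeat split; eauto; try (now left); intros x; simpl; tauto.
      + destruct HR as [<-|[]].
        exists 0, 0, false, (c1 :: c2 :: K); repeat split; eauto; try (now right; left);
          intros x; simpl; tauto. }
  destruct Hconc as (j & k & z & K' & HR'). destruct R as [u h v u' h' v'].
  destruct HR' as (Hincl & Hh & HK'). split; auto.
  intros z1 K1 H. apply Hincl in H.
  assert (HK'' : In K' Ks) by (destruct HK' as [<-|]; auto).
  simpl in H.
  repeat (destruct H as [H|H]; [inversion H; subst; auto|]). destruct H.
Qed.

(** * Encoding rewriting rules as formulae *)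

Lemma com_eq_dec (c d : com) : {c = d} + {c <> d}.
Proof. decide equality; apply Nat.eq_dec. Defined.

Fixpoint index (K : list com) (Ks : list (list com)) : nat :=
  match Ks with
  | [] => 0
  | K' :: Ks => if list_eq_dec com_eq_dec K K' then 0 else S (index K Ks)
  end.

Lemma nth_index K Ks : In K Ks -> nth (index K Ks) Ks [] = K.
Proof.
  induction Ks as [|K' Ks IH]; simpl; [easy|].
  destruct (list_eq_dec com_eq_dec K K') as [->|]; auto.
  intros [->|]; [congruence | auto].
Qed.

(** From 2 on, the residue modulo 3 separates registers, ordinary heads and scanning heads. A stack
    enters only through its position in [Ks], so fixed positions give fixed variables. *)
Definition encode (Ks : list (list com)) (x : letter) : nat :=
  match x with
  | LM => 0
  | RM => 1
  | Reg j => 3 * j + 2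
  | Hd false K => 3 * index K Ks + 3
  | Hd true K => 3 * index K Ks + 4
  end.

Definition decode (Ks : list (list com)) (n : nat) : letter :=
  match n with
  | 0 => LM
  | 1 => RM
  | S (S n) =>
      match n mod 3 with
      | 0 => Reg (n / 3)
      | 1 => Hd false (nth (n / 3) Ks [])
      | _ => Hd true (nth (n / 3) Ks [])
      end
  end.

Definition known (Ks : list (list com)) (x : letter) : Prop :=
  forall z K, x = Hd z K -> In K Ks.

Lemma decode_encode Ks x : known Ks x -> decode Ks (encode Ks x) = x.
Proof.
  assert (Hdiv : forall d r, r < 3 -> (3 * d + r) mod 3 = r /\ (3 * d + r) / 3 = d).
  { intros d r Hr. split.
    - symmetry. now apply Nat.mod_unique with d.
    - symmetry. now apply Nat.div_unique with r. }
  intros Hx. destruct x as [| |j|z K]; auto; unfold encode.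
  - replace (3 * j + 2) with (S (S (3 * j + 0))) by lia. unfold decode.
    destruct (Hdiv j 0) as [-> ->]; auto.
  - specialize (Hx z K eq_refl). set (d := index K Ks). destruct z.
    + replace (3 * d + 4) with (S (S (3 * d + 2))) by lia. unfold decode.
      destruct (Hdiv d 2) as [-> ->]; auto. unfold d. now rewrite nth_index.
    + replace (3 * d + 3) with (S (S (3 * d + 1))) by lia. unfold decode.
      destruct (Hdiv d 1) as [-> ->]; auto. unfold d. now rewrite nth_index.
Qed.

Definition atom (Ks : list (list com)) (x : letter) : formula := Var (encode Ks x).

(* In the 2018 calculi contraction consumes a doubled bracket, which the two
   diamonds supply anew at every step. *)
Definition active (c : calc) (A : formula) : formula :=
  match c with F2015 => A | _ => Diam (Diam A) end.

Definition letter_formula (c : calc) (Ks : list (list com)) (x : letter) : formula :=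
  match x with
  | Hd _ _ => active c (atom Ks x)
  | _ => atom Ks x
  end.

(** Folded so that the neighbour nearest to the head is consumed first. This and the next three
    folds have a core [C], so empty lists require no unit, which the restricted calculus lacks. *)
Definition unders (As : list formula) (C : formula) : formula :=
  fold_left (fun C A => Under A C) As C.

Definition overs (Bs : list formula) (C : formula) : formula :=
  fold_right (fun B C => Over C B) C Bs.

Definition prods_left (As : list formula) (C : formula) : formula :=
  fold_right Prod C As.

Definition prods_right (Bs : list formula) (C : formula) : formula :=
  fold_left Prod Bs C.

(** The consumed head is the bare [atom], because its diamonds are already spent when contraction
    has acted; the produced head is a [letter_formula], ready for the next step. *)
Definition rule_formula (c : calc) (Ks : list (list com)) (R : rule) : formula :=
  let (u, h, v, u', h', v') := R in
  let f := map (letter_formula c Ks) in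
  Over (Box (unders (f u) (overs (f v)
         (prods_left (f u') (prods_right (f v') (letter_formula c Ks h'))))))
    (atom Ks h).

Definition forms (As : list formula) : meta := map TF As.

(** * Rewriting steps as derivations *)

Section Derivations.

Context (c : calc).

Definition pure (A : formula) : Prop := mult_free A = true /\ one_free A = true.

Lemma pure_frag A : pure A -> frag_formula c A.
Proof. now intros [H1 H2]. Qed.

Lemma pure_binary A B :
  pure A -> pure B -> pure (Under A B) /\ pure (Over A B) /\ pure (Prod A B).
Proof. intros [H1 H2] [H3 H4]. unfold pure. simpl. now rewrite H1, H2, H3, H4. Qed.

Lemma pure_active A : pure A -> pure (active c A).
Proof. now destruct c. Qed.

Lemma pure_letter Ks x : pure (letter_formula c Ks x).
Proof. destruct x; try easy. now apply pure_active. Qed.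

Lemma pure_letters Ks w : Forall pure (map (letter_formula c Ks) w).
Proof. apply Forall_map, Forall_forall. intros; apply pure_letter. Qed.

Lemma pure_unders As C : Forall pure As -> pure C -> pure (unders As C).
Proof.
  intros H. revert C; induction H as [|A As HA _ IH]; intros C HC; auto.
  apply IH. now apply pure_binary.
Qed.

Lemma pure_overs As C : Forall pure As -> pure C -> pure (overs As C).
Proof. intros H HC. induction H; auto. now apply pure_binary. Qed.

Lemma pure_prods_left As C : Forall pure As -> pure C -> pure (prods_left As C).
Proof. intros H HC. induction H; auto. now apply pure_binary. Qed.

Lemma pure_prods_right As C : Forall pure As -> pure C -> pure (prods_right As C).
Proof.
  intros H. revert C; induction H as [|A As HA _ IH]; intros C HC; auto.
  apply IH. now apply pure_binary.
Qed.

Lemma pure_rule Ks R : pure (rule_formula c Ks R).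
Proof.
  destruct R as [u h v u' h' v']. apply pure_binary; [|easy].
  apply (pure_unders _ _ (pure_letters Ks u)), (pure_overs _ _ (pure_letters Ks v)),
    (pure_prods_left _ _ (pure_letters Ks u')), (pure_prods_right _ _ (pure_letters Ks v')),
    pure_letter.
Qed.

Lemma deriv_id A : pure A -> deriv c [TF A] A.
Proof. intros. now apply d_ax, pure_frag. Qed.

Lemma deriv_unders As C L R D :
  Forall pure As -> deriv c (L ++ TF C :: R) D ->
  deriv c (L ++ forms As ++ TF (unders As C) :: R) D.
Proof.
  intros H. revert L C; induction H as [|A As HA _ IH]; intros L C HD; auto.
  specialize (IH (L ++ [TF A]) (Under A C)). rewrite <- !app_assoc in IH.
  apply IH. apply (d_underL c Hole L R [TF A] A C D); [now apply deriv_id | exact HD].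
Qed.

Lemma deriv_overs Bs C L R D :
  Forall pure Bs -> deriv c (L ++ TF C :: R) D ->
  deriv c (L ++ TF (overs Bs C) :: forms Bs ++ R) D.
Proof.
  intros H HD. induction H as [|B Bs HB _ IH]; auto.
  apply (d_overL c Hole L (forms Bs ++ R) [TF B] B (overs Bs C) D);
    [now apply deriv_id | exact IH].
Qed.

Lemma deriv_prods_left As C L R D :
  deriv c (L ++ forms As ++ TF C :: R) D ->
  deriv c (L ++ TF (prods_left As C) :: R) D.
Proof.
  revert L; induction As as [|A As IH]; intros L HD; auto.
  apply (d_prodL c Hole L R A (prods_left As C) D).
  specialize (IH (L ++ [TF A])). rewrite <- !app_assoc in IH. apply IH, HD.
Qed.

Lemma deriv_prods_right Bs C L R D :
  deriv c (L ++ TF C :: forms Bs ++ R) D ->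
  deriv c (L ++ TF (prods_right Bs C) :: R) D.
Proof.
  revert C R; induction Bs as [|B Bs IH]; intros C R HD; auto.
  apply IH. now apply (d_prodL c Hole L (forms Bs ++ R) C B D).
Qed.

Lemma deriv_prods_left_R As C S :
  Forall pure As -> deriv c S C -> deriv c (forms As ++ S) (prods_left As C).
Proof.
  intros H HC. induction H as [|A As HA _ IH]; auto.
  apply (d_prodR c [TF A] (forms As ++ S)); auto. now apply deriv_id.
Qed.

(* [q] is shut in a bracket together with a copy of [!(Box Y / q)], which
   consumes it and turns the bracket into [Y]. *)
Lemma deriv_fire As q Y L R D :
  In (Over (Box Y) q) As -> pure q ->
  deriv c (bangs As ++ L ++ TF Y :: R) D ->
  deriv c (bangs As ++ L ++ TF (active c q) :: R) D.
Proof.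
  intros HA Hq HD. apply in_split in HA as (A1 & A2 & ->).
  set (A := Over (Box Y) q) in *. unfold bangs in *. rewrite map_app in *.
  cbn [map] in *. fold (bangs A1) (bangs A2) in *. rewrite <- app_assoc in *.
  change ((TF (Bang A) :: bangs A2) ++ ?S) with (TF (Bang A) :: bangs A2 ++ S) in *.
  (* The chosen [!A] is brought to the far left, where both contraction rules expect it, in the goal
     and in the hypothesis alike. *)
  apply (d_bangP1 c Hole [] (bangs A2 ++ L ++ TF (active c q) :: R) A (bangs A1)).
  apply (d_bangP2 c Hole [] (bangs A2 ++ L ++ TF Y :: R) A (bangs A1)) in HD.
  cbn [plug app] in *.
  set (G := bangs A1 ++ bangs A2 ++ L).
  replace (bangs A1 ++ bangs A2 ++ L ++ TF (active c q) :: R)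
    with (G ++ TF (active c q) :: R) by (unfold G; now rewrite <- !app_assoc).
  replace (bangs A1 ++ bangs A2 ++ L ++ TF Y :: R) with (G ++ TF Y :: R) in HD
    by (unfold G; now rewrite <- !app_assoc).
  set (G' := TF (Bang A) :: G).
  assert (H : deriv c (G' ++ TB [TF (Bang A); TF q] :: R) D).
  { apply (d_bangL c (InBr G' Hole R) [] [TF q] A).
    apply (d_overL c (InBr G' Hole R) [] [] [TF q] q (Box Y)).
    - now apply deriv_id.
    - now apply (d_boxL c Hole G' R Y). }
  (* Separates 2015 from the two 2018 calculi, which share one argument. *)
  destruct (Nat.eq_dec (match c with F2015 => 0 | _ => 1 end) 0) as [E|E].
  - assert (c = F2015) as Ec by now destruct c.
    replace (active c q) with q by now rewrite Ec.
    now apply (d_bangC15 c Hole [A] G [TF q] R D).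
  - assert (c <> F2015) as Ec by now intros ->.
    replace (active c q) with (Diam (Diam q)) by now destruct c.
    apply (d_diamL c Hole G' R (Diam q)).
    apply (d_diamL c (InBr G' Hole R) [] [] q).
    (* The bracket holds [q], so the nonemptiness condition on contraction is met. *)
    now apply (d_bangC18 c Hole A G [TF q] R D).
Qed.

(** The rules are attached to the left end marker: opened in the antecedent they stand at the left
    end, as contraction requires, and the same formula in the succedent collects them after the
    run. *)
Definition program_formula (N : nat) (Ks : list (list com)) : formula :=
  prods_left (map Bang (map (rule_formula c Ks) (rules N Ks))) (letter_formula c Ks LM).

Lemma pure_program N Ks : pure (program_formula N Ks).
Proof.
  apply pure_prods_left; [|apply pure_letter].
  apply Forall_map, Forall_map, Forall_forall. intros R _. apply (pure_rule Ks R).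
Qed.

Definition word_meta (Ks : list (list com)) (w : list letter) : meta :=
  forms (map (letter_formula c Ks) w).

Lemma deriv_rule N Ks R l r D :
  (forall K K', In K Ks -> In K' (next K) -> In K' Ks) ->
  In R (rules N Ks) ->
  let B := bangs (map (rule_formula c Ks) (rules N Ks)) in
  deriv c (B ++ word_meta Ks (l ++ rhs R ++ r)) D ->
  deriv c (B ++ word_meta Ks (l ++ lhs R ++ r)) D.
Proof.
  intros Hnext HR B HD. apply (in_rules_inv _ _ _ Hnext) in HR as Hinv.
  apply (in_map (rule_formula c Ks)) in HR.
  destruct R as [u h v u' h' v']. destruct Hinv as [(z & K & ->) _].
  unfold lhs, rhs, word_meta, forms in *.
  rewrite !map_app in *. cbn [map] in *. rewrite <- !app_assoc in *.
  cbn [app] in *. fold (forms (map (letter_formula c Ks) u)) in *.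
  rewrite (app_assoc (map TF (map _ l))).
  eapply deriv_fire; [exact HR | easy |].
  rewrite <- app_assoc, (app_assoc B). apply deriv_unders; [apply pure_letters|].
  apply deriv_overs; [apply pure_letters|].
  apply deriv_prods_left. rewrite app_assoc.
  apply deriv_prods_right. now rewrite <- !app_assoc.
Qed.

End Derivations.

(** * Truth of the rule formulae in the model *)

Section Faithfulness.

Context (c : calc) (Ks : list (list com)) (P : list letter -> Prop).

Let value (n : nat) : list letter := [decode Ks n].

Lemma fsem_letter x w :
  known Ks x -> (fsem P value (letter_formula c Ks x) w <-> below P w [x]).
Proof.
  intros Hx. rewrite <- (decode_encode Ks x Hx) at 2. now destruct x, c.
Qed.

Lemma fsem_unders u C w :
  Forall (known Ks) u ->
  (forall a, below P a u -> fsem P value C (a ++ w)) ->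
  fsem P value (unders (map (letter_formula c Ks) u) C) w.
Proof.
  intros Hu. revert C; induction Hu as [|x u Hx Hu IH]; intros C H.
  - apply (H []), below_refl.
  - apply IH. intros a Ha b Hb. apply fsem_letter in Hb; auto.
    rewrite app_assoc. apply H, (below_app P b [x] a u Hb Ha).
Qed.

Lemma fsem_overs v C w :
  Forall (known Ks) v ->
  (forall b, below P b v -> fsem P value C (w ++ b)) ->
  fsem P value (overs (map (letter_formula c Ks) v) C) w.
Proof.
  intros Hv. revert w; induction Hv as [|x v Hx Hv IH]; intros w H.
  - rewrite <- (app_nil_r w). apply H, below_refl.
  - intros b Hb. apply fsem_letter in Hb; auto.
    apply IH. intros a Ha. rewrite <- app_assoc.
    apply H, (below_app P b [x] a v Hb Ha).
Qed.

Lemma fsem_prods_left u C w w' :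
  Forall (known Ks) u -> fsem P value C w' -> below P w (u ++ w') ->
  fsem P value (prods_left (map (letter_formula c Ks) u) C) w.
Proof.
  intros Hu HC. revert w; induction Hu as [|x u Hx Hu IH]; intros w Hw.
  - now apply fsem_below with w'.
  - exists [x], (u ++ w'). split; [apply fsem_letter; auto using below_refl|].
    split; [apply IH, below_refl | exact Hw].
Qed.

Lemma fsem_prods_right v C w w' :
  Forall (known Ks) v -> fsem P value C w' -> below P w (w' ++ v) ->
  fsem P value (prods_right (map (letter_formula c Ks) v) C) w.
Proof.
  intros Hv. revert C w'; induction Hv as [|x v Hx Hv IH]; intros C w' HC Hw.
  - rewrite app_nil_r in Hw. now apply fsem_below with w'.
  - apply (IH _ (w' ++ [x])); [|now rewrite <- app_assoc].
    exists w', [x]. split; [exact HC|].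
    split; [apply fsem_letter; auto using below_refl | apply below_refl].
Qed.

(** Words below [u], [h] and [v] concatenate to a word below the left side, which closure of [P]
    puts below the right side. *)
Lemma fsem_rule u h v u' h' v' :
  (forall x, In x (u ++ h :: v ++ u' ++ h' :: v') -> known Ks x) ->
  (forall l r, P (l ++ (u' ++ h' :: v') ++ r) -> P (l ++ (u ++ h :: v) ++ r)) ->
  fsem P value (rule_formula c Ks (Rule u h v u' h' v')) [].
Proof.
  intros Hk HP b Hb. change (below P b [decode Ks (encode Ks h)]) in Hb.
  rewrite decode_encode in Hb
    by (apply Hk; rewrite in_app_iff; simpl; auto).
  apply fsem_unders.
  { apply Forall_forall. intros; apply Hk. rewrite in_app_iff; auto. }
  intros a Ha. apply fsem_overs.
  { apply Forall_forall. intros; apply Hk. rewrite !in_app_iff; simpl.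
    rewrite in_app_iff. auto. }
  intros d Hd. apply fsem_prods_left with (h' :: v').
  { apply Forall_forall. intros; apply Hk. rewrite !in_app_iff; simpl.
    rewrite !in_app_iff. auto. }
  - apply fsem_prods_right with [h'].
    + apply Forall_forall. intros; apply Hk. rewrite !in_app_iff; simpl.
      rewrite !in_app_iff. simpl. auto 6.
    + apply fsem_letter; [|apply below_refl]. apply Hk.
      rewrite !in_app_iff; simpl. rewrite !in_app_iff. simpl. auto 6.
    + apply below_refl.
  - apply below_trans with (u ++ h :: v); [|exact HP].
    rewrite <- app_assoc. simpl. apply below_app; [exact Ha|].
    now apply (below_app P b [h] d v).
Qed.

Lemma fsem_bangs As C w :
  (forall A, In A As -> fsem P value A []) -> fsem P value C w ->
  fsem P value (prods_left (map Bang As) C) w.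
Proof.
  intros HA HC. induction As as [|A As IH]; auto.
  exists [], w. split; [|split; [|apply below_refl]].
  - split; [apply below_refl | apply HA; now left].
  - apply IH. intros; apply HA. now right.
Qed.

Lemma fsem_bangs_inv As C w :
  fsem P value (prods_left (map Bang As) C) w -> fsem P value C w.
Proof.
  revert w; induction As as [|A As IH]; intros w; auto.
  intros (a & b & [Ha _] & Hb & Hw). apply IH in Hb.
  apply (fsem_below P value C _ b); auto.
  apply below_trans with (a ++ b); auto.
  apply (below_app P a [] b b Ha), below_refl.
Qed.

End Faithfulness.

(* Whatever the program, variables 1, 2, 3 and 6 stand for the right end marker,
   register 0 and the heads at the start and at the end of the program. *)
Definition start_meta (c : calc) (A : formula) (x : nat) : meta :=
  TF A :: TF (active c (Var 3)) :: repeat (TF (Var 2)) x ++ [TF (Var 1)].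

Definition goal (c : calc) (A : formula) : formula :=
  Prod (Prod A (active c (Var 6))) (Var 1).

(** The initial and the empty stack are put at positions 0 and 1, which gives their heads the
    variables 3 and 6 for every [p]. *)
Definition states (p : com) : list (list com) := [p] :: [] :: conts p [].

Definition program (c : calc) (p : com) : formula :=
  program_formula c (bound p) (states p).

Lemma states_next p K K' : In K (states p) -> In K' (next K) -> In K' (states p).
Proof.
  intros HK HK'. assert (K = [] \/ In K (conts p [])) as [->|H].
  { destruct HK as [<-|[<-|HK]]; auto using conts_self. }
  - destruct HK'.
  - destruct (conts_next p [] K K' H HK') as [->|]; [right; now left | right; now right].
Qed.

Lemma states_bound p K : In K (states p) -> Forall (fun c => bound c <= bound p) K.
Proof.
  intros [<-|[<-|HK]]; [now repeat constructor | constructor |].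
  now apply (conts_bound p []).
Qed.

Lemma encode_start p : encode (states p) (Hd false [p]) = 3.
Proof.
  unfold encode, states, index. now destruct (list_eq_dec com_eq_dec [p] [p]).
Qed.

Lemma encode_final p : encode (states p) (Hd false []) = 6.
Proof. reflexivity. Qed.

(** * Derivability of the program sequent is equivalent to halting *)

Lemma safe_final : safe [LM; Hd false []; RM].
Proof.
  intros l z K r E Hl Hr _.
  apply (unique_head l r [LM] z K [RM] false []) in E as (_ & _ & <- & _);
    auto using wf_left_not_head, wf_right_not_head.
  constructor.
Qed.

Lemma cnt_regs x j : cnt (repeat (Reg 0) x ++ [RM]) j = upd (fun _ => 0) 0 x j.
Proof.
  induction x as [|x IH]; simpl.
  - now destruct j.
  - rewrite IH. now destruct j.
Qed.

(** In the model with [P := safe], the initial configuration satisfies the antecedent, so by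
    soundness it lies below the final configuration. *)
Lemma deriv_halts c p x :
  deriv c (start_meta c (program c p) x) (goal c (program c p)) ->
  halts [p] (upd (fun _ => 0) 0 x).
Proof.
  intros HD. set (Ks := states p).
  set (value := fun n => [decode Ks n]).
  assert (Hstart : known Ks (Hd false [p])) by (intros z K [= <- <-]; now left).
  assert (Hfinal : known Ks (Hd false [])) by (intros z K [= <- <-]; right; now left).
  assert (Hprog : fsem safe value (program c p) [LM]).
  { apply fsem_bangs; [|now apply fsem_letter; [|apply below_refl]].
    intros A HA. apply in_map_iff in HA as (R & <- & HR).
    pose proof (in_rules_inv _ _ _ (states_next p) HR) as Hk.
    pose proof (rules_back _ _ _ HR) as Hback.
    destruct R as [u h v u' h' v']. apply fsem_rule; auto.
    intros y Hy z K ->. now apply Hk in Hy. }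
  set (w := [LM] ++ [Hd false [p]] ++ repeat (Reg 0) x ++ [RM]).
  assert (Hw : below safe w [LM; Hd false []; RM]).
  { apply (soundness safe value) in HD. destruct (HD w) as (a & b & Ha & Hb & Hab).
    - apply msem_cons. do 2 eexists. split; [reflexivity|]. split; [exact Hprog|].
      apply msem_cons. do 2 eexists. split; [reflexivity|]. split.
      + rewrite <- (encode_start p).
        now apply (fsem_letter c Ks safe (Hd false [p])); [|apply below_refl].
      + apply msem_app. do 2 eexists. split; [reflexivity|]. split.
        * clear HD w. induction x as [|x IH]; [reflexivity|].
          apply msem_cons. exists [Reg 0], (repeat (Reg 0) x).
          split; [reflexivity|]. split; [apply below_refl | apply IH].
        * apply msem_1I, below_refl.
    - destruct Ha as (a1 & a2 & H1 & H2 & Ha).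
      apply fsem_bangs_inv in H1.
      rewrite <- (encode_final p) in H2.
      apply (fsem_letter c Ks safe (Hd false [])) in H2; auto.
      apply below_trans with (a ++ b); auto.
      apply (below_app safe a [LM; Hd false []] b [RM]); auto.
      apply below_trans with (a1 ++ a2); auto.
      now apply (below_app safe a1 [LM] a2 [_]). }
  (* In the empty context [below] transfers safety from the final to the initial word, and safety of
     the latter means halting. *)
  specialize (Hw [] [] safe_final). rewrite app_nil_r in Hw. simpl in Hw.
  specialize (Hw [LM] false [p] (repeat (Reg 0) x ++ [RM]) eq_refl eq_refl).
  eapply halts_ext; [|apply Hw].
  - intros j. apply cnt_regs.
  - clear. now induction x.
  - discriminate.
Qed.

(** [0 < bound p] ensures that register 0, which holds the input, is among the letters covered by
    the rules. *)
Lemma halts_deriv c p x :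
  0 < bound p -> halts [p] (upd (fun _ => 0) 0 x) ->
  deriv c (start_meta c (program c p) x) (goal c (program c p)).
Proof.
  intros Hb Hh. set (Ks := states p).
  set (As := map (rule_formula c Ks) (rules (bound p) Ks)).
  apply (deriv_prods_left c (map Bang As) (Var 0) []).
  replace (forms (map Bang As)) with (bangs As)
    by (unfold forms, bangs; now rewrite map_map).
  pose proof (halts_G (bound p) Ks
    (fun w => deriv c (bangs As ++ word_meta c Ks w) (goal c (program c p)))
    (states_next p) (states_bound p)
    (fun R HR l r => deriv_rule c _ _ R l r _ (states_next p) HR)) as HG.
  cbn beta in HG.
  specialize (fun H => HG H [p] _ Hh (or_introl eq_refl) (repeat 0 x)).
  unfold config, word_meta, forms in HG. cbn [map app] in HG.
  rewrite map_repeat, !map_app, !map_repeat in HG.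
  cbn [map letter_formula] in HG. unfold atom in HG.
  unfold Ks in HG. rewrite encode_start, encode_final in HG. apply HG.
  (* The final configuration: the right marker and the final head are split off, and the remaining
     rules and left marker reassemble the program formula. *)
  - rewrite (app_assoc (bangs As) [_; _] [_] : _ ++ [_; _; _] = _).
    apply d_prodR; [|now apply deriv_id].
    rewrite (app_assoc (bangs As) [_] [_] : _ ++ [_; _] = _).
    apply d_prodR; [|now apply deriv_id, pure_active].
    unfold bangs. rewrite <- (map_map Bang TF).
    apply deriv_prods_left_R; [|now apply deriv_id].
    apply Forall_map, Forall_map, Forall_forall. intros R _. apply (pure_rule c Ks R).
  - apply Forall_forall. intros j Hj. now rewrite (repeat_spec _ _ _ Hj).
  - intros [|j]; [apply count_occ_repeat_eq | apply count_occ_repeat_neq]; auto.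
Qed.

(** * Diagonalization *)

Lemma eval_comp1 f g v x y : eval g v x -> eval f [x] y -> eval (RComp f [g]) v y.
Proof. intros Hg Hf. eapply e_comp; [repeat constructor; eassumption | exact Hf]. Qed.

Lemma eval_comp2 f g1 g2 v x1 x2 y :
  eval g1 v x1 -> eval g2 v x2 -> eval f [x1; x2] y -> eval (RComp f [g1; g2]) v y.
Proof. intros H1 H2 Hf. eapply e_comp; [repeat constructor; eassumption | exact Hf]. Qed.

Definition succ_of (g : recf) : recf := RComp RSucc [g].

Lemma eval_succ_of g v x : eval g v x -> eval (succ_of g) v (S x).
Proof. intros H. eapply eval_comp1; [exact H | constructor]. Qed.

Definition add_rec : recf := RPrim (RProj 0) (succ_of (RProj 1)).

Lemma eval_add n m : eval add_rec [n; m] (n + m).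
Proof.
  induction n as [|n IH]; [constructor; apply (e_proj 0)|].
  eapply e_primS; [exact IH|]. apply eval_succ_of, (e_proj 1).
Qed.

(** Triangular numbers by T(n+1) = (n+1) + T(n), which computes the quotient in [cpair] without
    dividing. *)
Definition tri_rec : recf :=
  RPrim RZero (RComp add_rec [succ_of (RProj 0); RProj 1]).

Lemma eval_tri n : eval tri_rec [n] (n * (n + 1) / 2).
Proof.
  induction n as [|n IH]; [repeat constructor|].
  eapply e_primS; [exact IH|].
  replace (S n * (S n + 1)) with (S n * 2 + n * (n + 1)) by lia.
  rewrite Nat.div_add_l by lia.
  eapply eval_comp2; [apply eval_succ_of, (e_proj 0) | apply (e_proj 1) | apply eval_add].
Qed.

Definition pair_of (g1 g2 : recf) : recf :=
  RComp (RComp add_rec [RComp tri_rec [add_rec]; RProj 1]) [g1; g2].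

Lemma eval_pair_of g1 g2 v x1 x2 :
  eval g1 v x1 -> eval g2 v x2 -> eval (pair_of g1 g2) v (cpair x1 x2).
Proof.
  intros H1 H2. eapply eval_comp2; [exact H1 | exact H2 |].
  eapply eval_comp2; [|apply (e_proj 1) | apply eval_add].
  eapply eval_comp1; [apply eval_add | apply eval_tri].
Qed.

Fixpoint const_rec (k : nat) : recf :=
  match k with 0 => RZero | S k => succ_of (const_rec k) end.

Lemma eval_const k v : eval (const_rec k) v k.
Proof. induction k; [constructor | now apply eval_succ_of]. Qed.

Definition repeat_rec (t e : nat) : recf :=
  RPrim (const_rec e) (succ_of (pair_of (const_rec t) (RProj 1))).

Lemma eval_repeat t l x :
  eval (repeat_rec (code_t t) (code_m l)) [x] (code_m (repeat t x ++ l)).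
Proof.
  induction x as [|x IH]; [constructor; apply eval_const|].
  eapply e_primS; [exact IH|].
  apply eval_succ_of, eval_pair_of; [apply eval_const | apply (e_proj 1)].
Qed.

(* Computes the code of the sequent that runs a program on its own code. *)
Definition self_rec (c : calc) : recf :=
  let d n := const_rec (code_f (active c (Var n))) in
  pair_of
    (succ_of (pair_of (pair_of (const_rec 0) (RProj 0))
      (succ_of (pair_of (pair_of (const_rec 0) (d 3))
        (RComp (repeat_rec (code_t (TF (Var 2))) (code_m [TF (Var 1)])) [RProj 0])))))
    (pair_of (const_rec 4)
      (pair_of (pair_of (const_rec 4) (pair_of (RProj 0) (d 6)))
        (const_rec (code_f (Var 1))))).

(** The constants 0 and 4 in [self_rec] are the tags of [TF] and [Prod] in the coding; the code of
    [A] serves both as a subformula code and as the number of input letters. *)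
Lemma eval_self c A :
  eval (self_rec c) [code_f A] (code_seq (start_meta c A (code_f A)) (goal c A)).
Proof.
  pose proof (e_proj 0 [code_f A]) as Hx. cbn [nth] in Hx.
  repeat first
    [ apply eval_const | exact Hx | apply eval_pair_of | apply eval_succ_of ].
  eapply eval_comp1; [exact Hx | apply eval_repeat].
Qed.

Lemma frag_start c p x :
  frag_sequent c (start_meta c (program c p) x) (goal c (program c p)).
Proof.
  assert (H : pure (program c p)) by apply pure_program.
  assert (Hv : forall n, pure (active c (Var n))) by (intros; now apply pure_active).
  split.
  - repeat constructor; try apply (pure_frag c); try apply H; try apply Hv.
    apply Forall_app. split; [|repeat constructor].
    apply Forall_forall. intros t Ht. rewrite (repeat_spec _ _ _ Ht).
    repeat constructor.
  - apply (pure_frag c), pure_binary; [|easy]. now apply pure_binary.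
Qed.

(** A positive register is decremented and incremented forever. The induction treats the two
    alternating stacks together: the one starting with [Inc r] never halts, as it leads back to the
    loop with a positive register. *)
Lemma halts_spin r s : halts [Loop r (Inc r)] s <-> s r = 0.
Proof.
  split.
  - enough (H : forall K s, halts K s ->
      (K = [Loop r (Inc r)] -> s r = 0) /\ (K = [Inc r; Loop r (Inc r)] -> False))
      by (intros Hh; now apply H in Hh as [Hh _]; apply Hh).
    clear s. induction 1 as [s|K s _ IH|r' K s _ IH|r' c K s E _ IH|r' c K s m E _ IH|
      c1 c2 K s _ IH]; split; intros [=]; subst; auto.
    + destruct IH as [IH _]. specialize (IH eq_refl). rewrite upd_same in IH. discriminate.
    + now destruct IH as [_ IH].
  - intros E. apply h_loop0; [exact E | constructor].
Qed.

Definition zero_test_program (h : recf) : com :=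
  Seq (compile h [0] 1 2) (Loop 1 (Inc 1)).

Lemma halts_zero_test h x y :
  eval h [x] y ->
  (halts [zero_test_program h] (upd (fun _ => 0) 0 x) <-> y = 0).
Proof.
  intros Hy. unfold zero_test_program. rewrite halts_seq.
  rewrite (runs_iff _ _ (upd (upd (fun _ => 0) 0 x) 1 y)).
  - rewrite halts_spin. now rewrite upd_same.
  - apply (compile_correct h _ _ Hy); auto.
    intros [|j] Hj; [lia | reflexivity].
Qed.

(** [p] and its formula [A] are fixed as soon as [f] is given. Self-reference comes from the input:
    [p] receives the code of [A] and itself builds from it the sequent about its own run. *)
Lemma undecidable c : ~ derivability_decidable c.
Proof.
  intros [f Hf].
  set (p := zero_test_program (RComp f [self_rec c])).
  set (A := program c p). set (x := code_f A).
  destruct (Hf _ _ (frag_start c p x)) as [Hyes Hno].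
  assert (Hrun : forall y,
    eval f [code_seq (start_meta c A x) (goal c A)] y ->
    (deriv c (start_meta c A x) (goal c A) <-> y = 0)).
  { intros y Hy. rewrite <- (halts_zero_test (RComp f [self_rec c]) x y).
    - split; [apply deriv_halts | apply halts_deriv].
      unfold p, zero_test_program. cbn [bound]. lia.
    - eapply eval_comp1; [apply eval_self | exact Hy]. }
  (* Derivability would make [f] answer 1, so [p] would not halt; once underivability is
     established, the answer 0 makes [p] halt. The argument stays constructive. *)
  assert (Hn : ~ deriv c (start_meta c A x) (goal c A)).
  { intros HD. apply (Hrun 1) in HD; [discriminate | now apply Hyes]. }
  now apply Hn, (Hrun 0 (Hno Hn)).
Qed.

Theorem theorem6 :
  ~ derivability_decidable F2015 /\
  ~ derivability_decidable F2018 /\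
  ~ derivability_decidable F2018minus.
Proof. repeat split; apply undecidable. Qed.
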